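(* Let $M$ be a semifinite von Neumann algebra with a faithful semifinite normal trace $\operatorname{tr}$. If $p$ and $q$ are positive real numbers with $p^{-1}+q^{-1}=1$, then for all $x,y\in M$, and for every choice of $x^{\dagger}\in\{x,x^*,|x|,|x^*|\}$ and $y^{\dagger}\in\{y,y^*,|y|,|y^*|\}$, $$\operatorname{tr}(|x^{\dagger}y^{\dagger}|)\;\le\;p^{-1}\operatorname{tr}(|x|^p)+q^{-1}\operatorname{tr}(|y|^q).$$
   Context: For $z\in M$, $|z|=(z^*z)^{1/2}$. The trace is defined on the positive cone $M^+$ with values in $[0,\infty]$. *)

(* Defs.v *)
From HB Require Import structures.
From mathcomp Require Import all_boot all_order all_algebra.
From mathcomp Require Export complex.
From mathcomp Require Import all_classical all_reals all_analysis.
Import Order.TTheory GRing.Theory Num.Theory.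
Import numFieldNormedType.Exports.

Set Implicit Arguments.
Unset Strict Implicit.
Unset Printing Implicit Defensive.

Local Open Scope classical_set_scope.
Local Open Scope complex_scope.
Local Open Scope ring_scope.

(* [inner] is linear in its first argument and conjugate-linear in its second. *)
Record hilbertType (R : realType) := Hilbert {
  hilbert_sort :> completeNormedModType R[i];
  inner : {dot hilbert_sort for Num.conj};
  inner_norm : forall u : hilbert_sort, inner u u = `|u| ^+ 2
}.

Definition bounded_op (R : realType) (H : hilbertType R) (a : H -> H) : Prop :=
  linear a /\ continuous a.

(* The set below is a singleton when [a] is bounded; otherwise the value of
   [adjoint a] is irrelevant. *)
Definition adjoint (R : realType) (H : hilbertType R) (a : H -> H) : H -> H :=
  xget 0 [set b | bounded_op b /\
                  forall u v, inner H (a u) v = inner H u (b v)].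

Definition commutant (R : realType) (H : hilbertType R) (S : set (H -> H)) :
    set (H -> H) :=
  [set b | bounded_op b /\ forall a, S a -> a \o b = b \o a].

(* Von Neumann algebras are taken as concrete algebras of bounded operators on
   a complex Hilbert space, with the definition of Dixmier and Takesaki. *)
Record von_neumann_algebra (R : realType) (H : hilbertType R)
    (M : set (H -> H)) : Prop := VonNeumannAlgebra {
  vna_bounded : forall a, M a -> bounded_op a;
  vna_id : M idfun;
  vna_add : forall a b, M a -> M b -> M (a + b);
  vna_scale : forall (c : R[i]) a, M a -> M (c *: a);
  vna_comp : forall a b, M a -> M b -> M (a \o b);
  vna_adjoint : forall a, M a -> M (adjoint a);
  vna_bicommutant : commutant (commutant M) = M
}.

(* In [R[i]], [0 <= z] says that [z] is real and nonnegative. *)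
Definition positive_op (R : realType) (H : hilbertType R) (a : H -> H) : Prop :=
  forall u, 0 <= inner H (a u) u.

Definition op_le (R : realType) (H : hilbertType R) (a b : H -> H) : Prop :=
  positive_op (b - a).

Definition positive_cone (R : realType) (H : hilbertType R) (M : set (H -> H)) :
    set (H -> H) :=
  [set a | M a /\ positive_op a].

(* A trace is a function on the positive cone of [M]: nothing is assumed about
   the values of [tr] elsewhere. In [\bar R] one has [0 * +oo = 0]. *)
Record is_trace (R : realType) (H : hilbertType R) (M : set (H -> H))
    (tr : (H -> H) -> \bar R) : Prop := IsTrace {
  trace_ge0 : forall a, positive_cone M a -> (0 <= tr a)%E;
  trace_add : forall a b, positive_cone M a -> positive_cone M b ->
    tr (a + b) = (tr a + tr b)%E;
  trace_scale : forall (c : R) a, 0 <= c -> positive_cone M a ->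
    tr (c%:C *: a) = (c%:E * tr a)%E;
  trace_comm : forall z, M z -> tr (adjoint z \o z) = tr (z \o adjoint z)
}.

Definition faithful_trace (R : realType) (H : hilbertType R) (M : set (H -> H))
    (tr : (H -> H) -> \bar R) : Prop :=
  forall a, positive_cone M a -> tr a = 0%E -> a = 0.

(* A von Neumann algebra carrying a faithful semifinite normal trace is
   automatically semifinite. *)
Definition semifinite_trace (R : realType) (H : hilbertType R)
    (M : set (H -> H)) (tr : (H -> H) -> \bar R) : Prop :=
  forall a, positive_cone M a -> a <> 0 ->
  exists b, [/\ positive_cone M b, b <> 0, op_le b a & (tr b < +oo)%E].

(* Increasing nets are replaced by their ranges, the upward directed sets. *)
Definition normal_trace (R : realType) (H : hilbertType R) (M : set (H -> H))
    (tr : (H -> H) -> \bar R) : Prop :=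
  forall (D : set (H -> H)) (a : H -> H),
  D !=set0 -> D `<=` positive_cone M ->
  (forall b c, D b -> D c -> exists d, [/\ D d, op_le b d & op_le c d]) ->
  positive_cone M a -> (forall b, D b -> op_le b a) ->
  (forall c, positive_cone M c -> (forall b, D b -> op_le b c) -> op_le a c) ->
  tr a = ereal_sup (tr @` D).

Definition spectrum (R : realType) (H : hilbertType R) (a : H -> H) : set R[i] :=
  [set l | ~ exists b, [/\ bounded_op b, b \o (a - l *: idfun) = idfun
                         & (a - l *: idfun) \o b = idfun]].

Definition poly_op (R : realType) (H : hilbertType R) (P : {poly R})
    (a : H -> H) : H -> H :=
  fun u => \sum_(i < size P) (P`_i)%:C *: iter i a u.

(* Continuous functional calculus: for [a] self-adjoint and [f] continuous on
   the (real) spectrum of [a], [fun_calculus f a] is the operator-norm limit of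
   [poly_op P a] for polynomials [P] tending to [f] uniformly on the spectrum. *)
Definition fun_calculus (R : realType) (H : hilbertType R) (f : R -> R)
    (a : H -> H) : H -> H :=
  xget 0 [set b | bounded_op b /\ forall e : R, 0 < e -> exists P : {poly R},
    (forall t : R, spectrum a t%:C -> `|P.[t] - f t| <= e) /\
    (forall u, `|poly_op P a u - b u| <= e%:C * `|u|)].

Definition power_op (R : realType) (H : hilbertType R) (a : H -> H) (r : R) :
    H -> H :=
  fun_calculus (fun t => powR t r) a.

Definition abs_op (R : realType) (H : hilbertType R) (z : H -> H) : H -> H :=
  power_op (adjoint z \o z) 2^-1.

Definition dagger_choices (R : realType) (H : hilbertType R) (x : H -> H) :
    set (H -> H) :=
  [set y | [\/ y = x, y = adjoint x, y = abs_op x | y = abs_op (adjoint x)]].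

(* Main.v *)
(* After replacing [x] by [|x|] and [y] by [|y^*|], which changes no trace, let [x = a] and
   [y = b] be positive and [z = a b]. Then [|z|] is the supremum of the operators [z^* G z],
   where [G = g_d (z z^* )] and [g_d t = sqrt t / (t + d)], and cyclicity gives
   [tr (z^* G z) = tr (r a b^2 a r)] with [r = sqrt G]. By normality [b] may be cut down to
   [B = (b - e)_+], whose powers have finite trace if [tr (b^q)] is finite. With the contraction [w = G a B],
   Cauchy-Schwarz bounds [tr (r a B^2 a r)] by the mean of
   [tr (sqrt B w^* a w sqrt B)] and [tr (sqrt B a sqrt B)]. Each of these is at most
   [tr (a^p) / p + tr (b^q) / q], by the scalar Young inequality in [a] once [b] is replaced,
   through a partition of unity, by the points of a grid. Replacing polar decompositions by
   functional calculus and normality keeps all traces on the positive cone. *)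

(* Formally, with [g = sqrt B], cyclicity turns tr (r a B^2 a r) = tr (B a G a B) into tr (g w^* a
   g), the mixed product of c = sqrt a w g and c' = sqrt a g; this dictates w = G a B. It is a
   contraction because w w^* is at most G z z^* G, the value at z z^* of t^2 / (t + d)^2. Since tr
   says nothing about g w^* a g, the Cauchy-Schwarz step compares sums of squares and cancels two of
   them, which must have finite trace. That is one purpose of the cutoff. The other concerns the
   grid: i e is the left end of the support of the i-th tent, so the tents weighted by i e add up to
   (t - e)_+ exactly, while those weighted by (i e)^q stay below t^q. Hence replacing b by numbers
   costs no error term, and the scalar inequality is applied to a alone although a and b do not
   commute. *)
From HB Require Import structures.
Require Import Defs.
From mathcomp Require Import all_boot all_order all_algebra.
From mathcomp Require Import all_classical all_reals all_analysis.
From mathcomp Require Import ring lra.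
Import Order.TTheory GRing.Theory Num.Theory.
Import numFieldNormedType.Exports.

Set Implicit Arguments.
Unset Strict Implicit.
Unset Printing Implicit Defensive.
Local Open Scope classical_set_scope.
Local Open Scope complex_scope.
Local Open Scope ring_scope.

(** * The real inner product *)

Section RealInner.
Context {R : realType} {H : hilbertType R}.
Implicit Types (u v w : H) (r : R).

(** Real parts suffice: by [innerE] the imaginary part of [inner H u v] is again a real part, taken
    at a multiple of [u]. *)
Definition ip u v : R := complex.Re (inner H u v).
Definition nm u : R := complex.Re `|u|.

Lemma normE u : `|u| = (nm u)%:C.
Proof. by rewrite /nm RRe_real // normr_real. Qed.

Lemma nm_ge0 u : 0 <= nm u.
Proof. by rewrite -ler0c -normE normr_ge0. Qed.

Lemma innerJ u v : inner H u v = ((inner H v u)^*)%C.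
Proof. by have := hermC (inner H) u v; rewrite expr0 mul1r. Qed.

Lemma ipC u v : ip u v = ip v u.
Proof. by rewrite /ip innerJ; case: (inner H v u). Qed.

Lemma ipDl u v w : ip (u + v) w = ip u w + ip v w.
Proof. by rewrite /ip linearDl /= raddfD. Qed.

Lemma ipZl r u v : ip (r%:C *: u) v = r * ip u v.
Proof. by rewrite /ip linearZl_LR /=; case: (inner H u v) => x y /=; rewrite mul0r subr0. Qed.

Lemma ipNl u v : ip (- u) v = - ip u v.
Proof. by rewrite /ip linearNl /= raddfN. Qed.

Lemma ipBl u v w : ip (u - v) w = ip u w - ip v w.
Proof. by rewrite ipDl ipNl. Qed.

Lemma ip0l u : ip 0 u = 0.
Proof. by rewrite /ip linear0l. Qed.

Lemma ipDr u v w : ip w (u + v) = ip w u + ip w v.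
Proof. by rewrite ipC ipDl !(ipC w). Qed.
Lemma ipZr r u v : ip v (r%:C *: u) = r * ip v u.
Proof. by rewrite ipC ipZl (ipC v). Qed.
Lemma ipNr u v : ip v (- u) = - ip v u.
Proof. by rewrite ipC ipNl ipC. Qed.
Lemma ipBr u v w : ip w (u - v) = ip w u - ip w v.
Proof. by rewrite ipDr ipNr. Qed.
Lemma ip0r u : ip u 0 = 0.
Proof. by rewrite ipC ip0l. Qed.

Lemma ipuu u : ip u u = nm u ^+ 2.
Proof. by rewrite /ip inner_norm normE -rmorphXn. Qed.

Lemma nm_eq0 u : (nm u == 0) = (u == 0).
Proof. by rewrite -(normr_eq0 u) normE -(inj_eq (@complexI R)) rmorph0. Qed.

Lemma nm0 : nm 0 = 0.
Proof. by apply/eqP; rewrite nm_eq0. Qed.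

Lemma nmZ r u : nm (r%:C *: u) = `|r| * nm u.
Proof.
apply: complexI; rewrite -normE normrZ normE rmorphM; congr (_ * _).
by rewrite normc_def /= expr0n /= addr0 sqrtr_sqr.
Qed.

Lemma nmD u v : nm (u + v) <= nm u + nm v.
Proof. by rewrite -lecR rmorphD /= -!normE ler_normD. Qed.

Lemma nmN u : nm (- u) = nm u.
Proof. by rewrite /nm normrN. Qed.

Lemma nmBC u v : nm (u - v) = nm (v - u).
Proof. by rewrite -nmN opprB. Qed.

Lemma cauchy_schwarz u v : ip u v <= nm u * nm v.
Proof.
have [/eqP|] := boolP (nm u * nm v == 0).
  move=> /[dup] E /eqP; rewrite mulf_eq0 !nm_eq0 => /orP[] /eqP e; move: E; rewrite e.
    by move=> ->; rewrite ip0l.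
  by move=> ->; rewrite ip0r.
move=> n0; have n1 : 0 < nm u * nm v by rewrite lt0r n0 mulr_ge0 ?nm_ge0.
have := sqr_ge0 (nm ((nm v)%:C *: u - (nm u)%:C *: v)).
rewrite -ipuu !(ipBl, ipBr, ipZl, ipZr) !ipuu (ipC v u) => h.
suff: 0 <= 2 * (nm u * nm v) * (nm u * nm v - ip u v).
  by rewrite pmulr_rge0 ?subr_ge0 // mulr_gt0.
by apply: le_trans h _; rewrite le_eqVlt; apply/orP; left; apply/eqP; ring.
Qed.

Lemma ip_eq u v : (forall w, ip u w = ip v w) -> u = v.
Proof.
move=> h; apply/eqP; rewrite -subr_eq0 -nm_eq0 -sqrf_eq0 -ipuu ipBl.
by rewrite h subrr.
Qed.

Lemma ip_iC u v : ip ('i%C *: u) v = complex.Re ('i%C * inner H u v).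
Proof. by rewrite /ip linearZl_LR. Qed.

Lemma innerE u v : inner H u v = ip u v +i* - ip ('i%C *: u) v.
Proof.
rewrite ip_iC mulrC ReiNIm opprK /ip.
by case: (inner H u v).
Qed.

Lemma seq_cvg (x : nat -> H) :
  (forall e : R, 0 < e -> exists N, forall m n, (N <= m)%N -> (N <= n)%N -> nm (x m - x n) <= e) ->
  exists l, forall e : R, 0 < e -> exists N, forall n, (N <= n)%N -> nm (x n - l) <= e.
Proof.
move=> cx.
have : cauchy (x @ \oo).
  apply/cauchy_exP => e e0.
  have e0' : 0 < complex.Re e by move: e0; rewrite ltcE /= => /andP[].
  have eE : e = (complex.Re e)%:C by rewrite RRe_real // gtr0_real.
  have [N HN] := cx _ (divr_gt0 e0' (ltr0n _ 2)).
  exists (x N); exists N => // n /= Nn.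
  rewrite -ball_normE /= normE eE ltcR.
  by apply: le_lt_trans (HN N n (leqnn _) Nn) _; lra.
move=> /cauchy_cvgP /cvg_ex [l /cvgrPdist_le hl]; exists l => e e0.
have /hl [N _ HN] : 0 < e%:C by rewrite ltcR.
exists N => n Nn; rewrite nmBC -lecR -normE; exact: HN.
Qed.

End RealInner.

(** * Quadratic minimisation and representation of functionals *)

Section Riesz.
Context {R : realType} {H : hilbertType R}.
Implicit Types (u v w : H) (r : R).

Lemma le0_of_eps r : (forall e, 0 < e -> r <= e) -> r <= 0.
Proof.
move=> h; rewrite leNgt; apply/negP => r0.
by have := h (r / 2) ltac:(lra); lra.
Qed.

Lemma archi_inv (e : R) : 0 < e -> exists N, forall n, (N <= n)%N -> n.+1%:R^-1 <= e.
Proof.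
move=> e0; exists (Num.truncn e^-1) => n hn.
rewrite -[e]invrK lef_pV2 ?posrE ?invr_gt0 //.
apply: ltW; apply: lt_le_trans (truncnS_gt _) _.
by rewrite ler_nat ltnS.
Qed.

(* Minimise [ip (a u) u - 2 f u]: a minimising sequence is Cauchy by the
   parallelogram identity. *)
Lemma lax_milgram (a : H -> H) (f : H -> R) (m C K : R) :
  0 < m ->
  (forall u v, a (u + v) = a u + a v) -> (forall r u, a (r%:C *: u) = r%:C *: a u) ->
  (forall u v, ip (a u) v = ip u (a v)) ->
  (forall u, m * nm u ^+ 2 <= ip (a u) u) -> (forall u, nm (a u) <= C * nm u) ->
  (forall u v, f (u + v) = f u + f v) -> (forall r u, f (r%:C *: u) = r * f u) ->
  (forall u, `|f u| <= K * nm u) ->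
  exists l, forall v, ip (a l) v = f v.
Proof.
move=> m0 aD aZ asym am aC fD fZ fK.
pose J u := ip (a u) u - 2 * f u.
have Jlb u : - (K ^+ 2 / m) <= J u.
  rewrite /J; have := am u; have := fK u; rewrite ler_norml => /andP[_ h1] h2.
  suff : 0 <= m * nm u ^+ 2 - 2 * (K * nm u) + K ^+ 2 / m by lra.
  have -> : m * nm u ^+ 2 - 2 * (K * nm u) + K ^+ 2 / m = m * (nm u - K / m) ^+ 2.
    by field; rewrite gt_eqF.
  by rewrite mulr_ge0 ?sqr_ge0 // ltW.
have hi : has_inf (range J).
  by split; [exists (J 0), 0 | exists (- (K ^+ 2 / m)) => _ [u _ <-]].
set j := inf (range J).
have jle u : j <= J u by apply: ge_inf; [case: hi | exists u].
have /choice [x hx] : forall n : nat, exists u, J u <= j + n.+1%:R^-1.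
  move=> n; have n0 : 0 < n.+1%:R^-1 :> R by rewrite invr_gt0.
  have [_ [u _ <-] hu] := inf_adherent n0 hi.
  by exists u; apply: ltW.
have par u v : m / 2 * nm (u - v) ^+ 2 <= J u + J v - 2 * j.
  have h1 := jle ((2^-1)%:C *: (u + v)).
  have h2 := am (u - v).
  suff E : J u + J v - 2 * J ((2^-1)%:C *: (u + v)) = ip (a (u - v)) (u - v) / 2 by lra.
  have aB : a (u - v) = a u - a v.
    rewrite aD; congr (_ + _).
    have -> : - v = (-1)%:C *: v by rewrite rmorphN rmorph1 scaleN1r.
    by rewrite aZ rmorphN rmorph1 scaleN1r.
  rewrite /J aB aZ aD fZ fD !(ipBl, ipBr, ipZl, ipZr, ipDl, ipDr) (asym v u) (ipC v).
  by field.
have [l hl] : exists l, forall e : R, 0 < e -> exists N, forall n, (N <= n)%N -> nm (x n - l) <= e.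
  apply: seq_cvg => e e0.
  have [N HN] := archi_inv (divr_gt0 (mulr_gt0 m0 (exprn_gt0 2 e0)) (ltr0n _ 4)).
  exists N => k n Nk Nn.
  rewrite -(ler_pXn2r (ltn0Sn 1)) ?nnegrE ?nm_ge0 ?(ltW e0) //.
  rewrite -(ler_pM2l m0).
  have := par (x k) (x n); have := hx k; have := hx n; have := HN _ Nk; have := HN _ Nn.
  move: (J _) (J _) (n.+1%:R^-1) (k.+1%:R^-1) (nm _ ^+ 2) => J1 J2 i1 i2 d.
  by clear -m0 e0; move: (e ^+ 2) j => e2 j; move=> *; nra.
exists l => v; apply/eqP; rewrite -subr_eq0 -normr_eq0 eq_le normr_ge0 andbT.
have A0 : 0 < ip (a v) v + 1.
  by have := am v; have := mulr_ge0 (ltW m0) (sqr_ge0 (nm v)); lra.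
(* Moving [x n] along [v] by [- (g / A)] lowers [J] by at least [g ^+ 2 / A], while [J] can drop by
   at most [n.+1%:R^-1]. The [+ 1] in [A] keeps it positive when [v = 0]. *)
have gn n : (ip (a (x n)) v - f v) ^+ 2 <= (ip (a v) v + 1) * n.+1%:R^-1.
  set g := ip _ _ - _; set A := _ + 1.
  have h := jle (x n + (- (g / A))%:C *: v); have h' := hx n.
  have E : J (x n + (- (g / A))%:C *: v) = J (x n) - 2 * (g / A) * g + (g / A) ^+ 2 * (A - 1).
    rewrite /J aD aZ fD fZ !(ipDl, ipDr, ipZl, ipZr) (asym v) (ipC v) /g /A.
    by ring.
  have : (2 * (g / A) * g - (g / A) ^+ 2 * (A - 1)) <= n.+1%:R^-1.
    move: h h'; rewrite E; move: (J _) (n.+1%:R^-1) (2 * _ * g) (_ * (A - 1)) => ? ? ? ?; move: (j) => ?.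
    by lra.
  have -> : 2 * (g / A) * g - (g / A) ^+ 2 * (A - 1) = g ^+ 2 / A + (g / A) ^+ 2.
    by field; rewrite gt_eqF.
  move=> hh; rewrite mulrC -ler_pdivrMr //; apply: le_trans hh.
  by rewrite lerDl sqr_ge0.
apply: le0_of_eps => e e0.
have C'0 : 0 < `|C| * nm v + 1 by rewrite ltr_pwDr // mulr_ge0 ?nm_ge0.
have [N1 HN1] := hl _ (divr_gt0 (divr_gt0 e0 (ltr0n _ 2)) C'0).
have [N2 HN2] := archi_inv (divr_gt0 (exprn_gt0 2 (divr_gt0 e0 (ltr0n _ 2))) A0).
pose n := maxn N1 N2.
have b1 : `|ip (a (x n)) v - f v| <= e / 2.
  rewrite -(ler_pXn2r (ltn0Sn 1)) ?nnegrE ?normr_ge0 ?divr_ge0 ?(ltW e0) //.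
  rewrite real_normK ?num_real //; apply: le_trans (gn n) _.
  rewrite mulrC -ler_pdivlMr //; apply: HN2; exact: leq_maxr.
have b2 : `|ip (a l) v - ip (a (x n)) v| <= e / 2.
  have -> : ip (a l) v - ip (a (x n)) v = ip (l - x n) (a v) by rewrite ipBl !asym.
  have cs : `|ip (l - x n) (a v)| <= nm (l - x n) * nm (a v).
    rewrite ler_norml; apply/andP; split; last exact: cauchy_schwarz.
    by rewrite lerNl -ipNl; apply: le_trans (cauchy_schwarz _ _) _; rewrite nmN.
  apply: le_trans cs _; have := HN1 n (leq_maxl _ _); rewrite nmBC ler_pdivlMr // => h.
  apply: le_trans h; apply: ler_wpM2l; first exact: nm_ge0.
  apply: le_trans (aC v) _; apply: le_trans (_ : `|C| * nm v <= _).
    by rewrite ler_wpM2r ?nm_ge0 // ler_norm.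
  by rewrite lerDl.
have -> : ip (a l) v - f v = (ip (a l) v - ip (a (x n)) v) + (ip (a (x n)) v - f v) by ring.
by apply: le_trans (ler_normD _ _) _; lra.
Qed.

End Riesz.

(** * Bounded operators *)

Section BoundedOperators.
Context {R : realType} {H : hilbertType R}.
Implicit Types (u v w : H) (r : R).

Lemma bounded_opW (a : H -> H) : linear a ->
  (exists C : R, forall u, nm (a u) <= C * nm u) -> bounded_op a.
Proof.
move=> la [C hC]; split=> //.
pose am := GRing.isLinear.Build _ _ _ _ a la.
pose al : {linear H -> H} := HB.pack a am.
have : bounded_near al (nbhs (0 : H)).
  apply/bounded_funP => r.
  exists (`|C|%:C * `|r|) => x /= xr.
  rewrite (_ : `|r| = r); last by rewrite ger0_norm // (le_trans _ xr).
  rewrite normE; rewrite normE in xr.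
  apply: (@le_trans _ _ (`|C|%:C * (nm x)%:C)); last by rewrite ler_wpM2l // lecR.
  rewrite -rmorphM lecR; apply: le_trans (hC x) _.
  by rewrite ler_wpM2r ?nm_ge0 // ler_norm.
exact: bounded_linear_continuous.
Qed.

Lemma bounded_op_bound (a : H -> H) : bounded_op a ->
  exists2 C : R, 0 <= C & forall u, nm (a u) <= C * nm u.
Proof.
move=> [la ca].
pose am := GRing.isLinear.Build _ _ _ _ a la.
pose al : {linear H -> H} := HB.pack a am.
have /continuous_linear_bounded : {for 0, continuous al} by exact: ca.
move=> /(_ 0) /linear_boundedP /pinfty_ex_gt0 [C C0 hC].
have C0' : 0 <= complex.Re C by move: C0; rewrite ltcE /= => /andP[_ /ltW].
exists (complex.Re C) => // u.
have := hC u; rewrite !normE /=.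
by rewrite -(RRe_real (gtr0_real C0)) -rmorphM lecR.
Qed.

(** Bundled so that operators form a ring under composition; powers, big sums and ring lemmas then
    apply. *)
Record bop := Bop { bfun :> H -> H; bopP : bounded_op bfun }.

Lemma bop_eq (a b : bop) : bfun a = bfun b -> a = b.
Proof. by case: a b => [a pa] [b pb] /= e; subst b; congr Bop; exact: Prop_irrelevance. Qed.

Lemma bopext (a b : bop) : a =1 b -> a = b.
Proof. by move=> /funext; exact: bop_eq. Qed.

Lemma bopD (a : bop) u v : a (u + v) = a u + a v.
Proof. by have [/(_ 1 u v)] := bopP a; rewrite !scale1r. Qed.

Lemma bop0 (a : bop) : a 0 = 0.
Proof. by apply: (addrI (a 0)); rewrite -bopD !addr0. Qed.

Lemma bopZC (a : bop) (c : R[i]) u : a (c *: u) = c *: a u.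
Proof. by have [/(_ c u 0)] := bopP a; rewrite bop0 !addr0. Qed.

Lemma bopN (a : bop) u : a (- u) = - a u.
Proof. by rewrite -scaleN1r bopZC scaleN1r. Qed.

Lemma bopB (a : bop) u v : a (u - v) = a u - a v.
Proof. by rewrite bopD bopN. Qed.

(* [opb c a]: the operator norm of [a] is at most [c]. *)
Definition opb (c : R) (a : H -> H) := forall u, nm (a u) <= c * nm u.

Lemma bop_opb (a : bop) : exists2 C : R, 0 < C & opb C a.
Proof.
have [C C0 hC] := bounded_op_bound (bopP a).
exists (C + 1); first by rewrite ltr_wpDl.
by move=> u; apply: le_trans (hC u) _; rewrite ler_wpM2r ?nm_ge0 // lerDl.
Qed.

Fact badd_subproof (a b : bop) : bounded_op (fun u => a u + b u).
Proof.
apply: bounded_opW => [c u v|].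
  by rewrite !bopD !bopZC scalerDr; rewrite addrACA.
have [C _ hC] := bop_opb a; have [D _ hD] := bop_opb b.
exists (C + D) => u; apply: le_trans (nmD _ _) _.
by rewrite mulrDl lerD.
Qed.
Definition badd a b := Bop (badd_subproof a b).

Fact bscale_subproof (c : R[i]) (a : bop) : bounded_op (fun u => c *: a u).
Proof.
apply: bounded_opW => [d u v|].
  by rewrite !bopD !bopZC scalerDr !scalerA mulrC.
have [C _ hC] := bop_opb a.
exists (complex.Re `|c| * C) => u.
have -> : nm (c *: a u) = complex.Re `|c| * nm (a u).
  apply: complexI; rewrite -normE normrZ normE rmorphM; congr (_ * _).
rewrite -mulrA ler_wpM2l //.
by rewrite normc_def /= sqrtr_ge0.
Qed.
Definition bscale c a := Bop (bscale_subproof c a).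

Fact bzero_subproof : bounded_op (fun _ : H => 0 : H).
Proof.
apply: bounded_opW => [d u v|]; first by rewrite scaler0 addr0.
by exists 0 => u; rewrite nm0 mul0r.
Qed.
Definition bzero := Bop bzero_subproof.

Fact bone_subproof : bounded_op (fun u : H => u).
Proof.
apply: bounded_opW => [//|].
by exists 1 => u; rewrite mul1r.
Qed.
Definition bone := Bop bone_subproof.

Fact bmul_subproof (a b : bop) : bounded_op (fun u => a (b u)).
Proof.
apply: bounded_opW => [d u v|]; first by rewrite !bopD !bopZC.
have [C C0 hC] := bop_opb a; have [D _ hD] := bop_opb b.
exists (C * D) => u; apply: le_trans (hC _) _.
by rewrite -mulrA ler_wpM2l // ltW.
Qed.
Definition bmul a b := Bop (bmul_subproof a b).

Definition bopp a := bscale (-1) a.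

HB.instance Definition _ := gen_eqMixin bop.
HB.instance Definition _ := gen_choiceMixin bop.

Fact baddA : associative badd. Proof. by move=> a b c; apply: bopext => u /=; rewrite addrA. Qed.
Fact baddC : commutative badd. Proof. by move=> a b; apply: bopext => u /=; rewrite addrC. Qed.
Fact badd0 : left_id bzero badd. Proof. by move=> a; apply: bopext => u /=; rewrite add0r. Qed.
Fact baddN : left_inverse bzero bopp badd.
Proof. by move=> a; apply: bopext => u /=; rewrite scaleN1r addNr. Qed.
HB.instance Definition _ := GRing.isZmodule.Build bop baddA baddC badd0 baddN.

Fact bmulA : associative bmul. Proof. by move=> a b c; apply: bopext. Qed.
Fact bmul1l : left_id bone bmul. Proof. by move=> a; apply: bopext. Qed.
Fact bmul1r : right_id bone bmul. Proof. by move=> a; apply: bopext. Qed.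
Fact bmulDl : left_distributive bmul (@GRing.add bop). Proof. by move=> a b c; apply: bopext. Qed.
Fact bmulDr : right_distributive bmul (@GRing.add bop).
Proof. by move=> a b c; apply: bopext => u /=; rewrite bopD. Qed.
HB.instance Definition _ := GRing.Zmodule_isPzRing.Build bop bmulA bmul1l bmul1r bmulDl bmulDr.

(** Scalars are restricted to the reals so that [star] is linear and the real polynomials of the
    calculus act. *)
Definition brscale (r : R) (a : bop) := bscale r%:C a.
Fact brscaleA r s (a : bop) : brscale r (brscale s a) = brscale (r * s) a.
Proof. by apply: bopext => u /=; rewrite scalerA rmorphM. Qed.
Fact brscale1 : left_id 1 brscale.
Proof. by move=> a; apply: bopext => u /=; rewrite scale1r. Qed.
Fact brscaleDr : right_distributive brscale (@GRing.add bop).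
Proof. by move=> r a b; apply: bopext => u /=; rewrite scalerDr. Qed.
Fact brscaleDl (a : bop) : {morph brscale^~ a : r s / r + s}.
Proof. by move=> r s; apply: bopext => u /=; rewrite rmorphD scalerDl. Qed.
HB.instance Definition _ := GRing.Zmodule_isLmodule.Build R bop brscaleA brscale1 brscaleDr brscaleDl.

Lemma bscalerAl r (a b : bop) : (r *: a) * b = r *: (a * b).
Proof. by apply: bopext. Qed.
Lemma bscalerAr r (a b : bop) : a * (r *: b) = r *: (a * b).
Proof. by apply: bopext => u /=; rewrite bopZC. Qed.

Lemma bopDE (a b : bop) u : (a + b) u = a u + b u. Proof. by []. Qed.
Lemma bopNE (a : bop) u : (- a) u = - a u. Proof. by rewrite /= scaleN1r. Qed.
Lemma bopBE (a b : bop) u : (a - b) u = a u - b u. Proof. by rewrite bopDE bopNE. Qed.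
Lemma bopME (a b : bop) u : (a * b) u = a (b u). Proof. by []. Qed.
Lemma bopZE r (a : bop) u : (r *: a) u = r%:C *: a u. Proof. by []. Qed.
Lemma bop1E u : (1 : bop) u = u. Proof. by []. Qed.
Lemma bop0E u : (0 : bop) u = 0. Proof. by []. Qed.
Definition bopE := (bopBE, bopDE, bopNE, bopME, bopZE, bop1E, bop0E).
Lemma bopZ (a : bop) r u : a (r%:C *: u) = r%:C *: a u.
Proof. exact: bopZC. Qed.

End BoundedOperators.
Arguments bop {R} H.

(** * Adjoints, positivity, inverses *)

Notation "r %:B" := (r *: (1 : bop _)) (at level 1, left associativity, format "r %:B") : ring_scope.

Section Star.
Context {R : realType} {H : hilbertType R}.
Implicit Types (u v w : H) (r : R) (a b c : bop H).

Lemma ipZCr (z : R[i]) u v : ip u (z *: v) = ip ((z^*)%C *: u) v.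
Proof. by rewrite /ip linearZr_LR linearZl_LR. Qed.

Lemma ip_norm_le u v : `|ip u v| <= nm u * nm v.
Proof.
rewrite ler_norml cauchy_schwarz andbT lerNl -ipNl.
by apply: le_trans (cauchy_schwarz _ _) _; rewrite nmN.
Qed.

(** Riesz representation of [w |-> ip (a w) v], the case of [lax_milgram] whose quadratic form is
    the squared norm. Representatives are unique already for the real form, and the complex
    linearity of [b] is recovered from that of [a]. *)
Lemma star_exists a : exists b, forall u v, ip (a u) v = ip u (b v).
Proof.
have [C C0 hC] := bop_opb a.
have /choice [b hb] v : exists l, forall w, ip l w = ip (a w) v.
  apply: (@lax_milgram _ _ id _ 1 1 (C * nm v)) => //.
  - by move=> u; rewrite mul1r ipuu.
  - by move=> u; rewrite mul1r.
  - by move=> u w; rewrite bopD ipDl.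
  - by move=> r u; rewrite bopZ ipZl.
  move=> u; apply: le_trans (ip_norm_le _ _) _.
  by rewrite mulrAC ler_wpM2r ?nm_ge0.
have bb : bounded_op b.
  apply: bounded_opW.
    move=> z u v; apply: ip_eq => w.
    rewrite hb ipDr ipDl hb; congr (_ + _).
    by rewrite ipZCr -bopZC -hb ipZCr conjcK.
  exists C => v; have [->|b0] := eqVneq (b v) 0; first by rewrite nm0 mulr_ge0 ?nm_ge0 ?ltW.
  have p0 : 0 < nm (b v) by rewrite lt0r nm_eq0 b0 nm_ge0.
  rewrite -(ler_pM2r p0) -expr2 -ipuu hb; apply: le_trans (cauchy_schwarz _ _) _.
  by rewrite mulrAC ler_wpM2r ?nm_ge0.
by exists (Bop bb) => u v; rewrite [RHS]ipC hb.
Qed.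

Definition star a : bop H := sval (cid (star_exists a)).

Lemma starE a u v : ip (a u) v = ip u (star a v).
Proof. exact: (svalP (cid (star_exists a))). Qed.

Lemma starP a b : (forall u v, ip (a u) v = ip u (b v)) -> star a = b.
Proof.
move=> h; apply: bopext => v; apply: ip_eq => w.
by rewrite ipC -starE h ipC.
Qed.

Lemma starK a : star (star a) = a.
Proof. by apply: starP => u v; rewrite ipC -starE ipC. Qed.

Lemma starD a b : star (a + b) = star a + star b.
Proof. by apply: starP => u v; rewrite !bopE ipDl ipDr !starE. Qed.

Lemma starZ r a : star (r *: a) = r *: star a.
Proof. by apply: starP => u v; rewrite !bopE ipZl ipZr !starE. Qed.

Lemma starN a : star (- a) = - star a.
Proof. by rewrite -(scaleN1r a) starZ scaleN1r. Qed.

Lemma starB a b : star (a - b) = star a - star b.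
Proof. by rewrite starD starN. Qed.

Lemma starM a b : star (a * b) = star b * star a.
Proof. by apply: starP => u v; rewrite !bopE !starE. Qed.

Lemma star1 : star 1 = 1 :> bop H. Proof. by apply: starP. Qed.
Lemma star0 : star 0 = 0 :> bop H. Proof. by apply: starP => u v; rewrite ip0l ip0r. Qed.

(** [star a] lies in the set that defines [adjoint a], and by [starP] real parts alone determine any
    member, so [xget] can only return [star a]. *)
Lemma adjointE a : adjoint a = star a.
Proof.
rewrite /adjoint; set S := [set b | _].
have : S (star a).
  split; first exact: bopP.
  by move=> u v; rewrite !innerE starE -bopZC starE.
move=> Ss; have [bb hb] : S (xget 0 S) by case: xgetP => // /(_ _ Ss).
change (xget 0 S = bfun (star a)).
have -> // : star a = Bop bb.
by apply: starP => u v; rewrite /ip hb.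
Qed.

Definition selfadj a := star a = a.

(** Self-adjointness is asked for separately because [ip] is a real part: a skew-adjoint [a] has
    [ip (a u) u = 0] for all [u]. *)
Definition pos a := selfadj a /\ forall u, 0 <= ip (a u) u.

Definition ple a b := pos (b - a).

Lemma pos_sa a : pos a -> selfadj a. Proof. by case. Qed.
Lemma pos_ip a u : pos a -> 0 <= ip (a u) u. Proof. by case. Qed.
Lemma pos0 : pos 0. Proof. by split; [exact: star0|move=> u; rewrite bopE ip0l]. Qed.
Lemma pos1 : pos 1. Proof. by split; [exact: star1|move=> u; rewrite bopE ipuu sqr_ge0]. Qed.
Lemma posD a b : pos a -> pos b -> pos (a + b).
Proof.
move=> [sa pa] [sb pb]; split; first by rewrite /selfadj starD sa sb.
by move=> u; rewrite bopE ipDl addr_ge0.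
Qed.
Lemma posZ r a : 0 <= r -> pos a -> pos (r *: a).
Proof.
move=> r0 [sa pa]; split; first by rewrite /selfadj starZ sa.
by move=> u; rewrite bopE ipZl mulr_ge0.
Qed.
Lemma pos_sum (I : Type) (s : seq I) (F : I -> bop H) :
  (forall i, pos (F i)) -> pos (\sum_(i <- s) F i).
Proof. by move=> h; elim/big_ind: _ => //; [exact: pos0 | exact: posD]. Qed.
Lemma pos_conj a c : pos a -> pos (star c * a * c).
Proof.
move=> [sa pa]; split; first by rewrite /selfadj !starM sa starK mulrA.
by move=> u; rewrite !bopE ipC -starE ipC.
Qed.
Lemma pos_starM c : pos (star c * c).
Proof. by rewrite -[star c]mulr1; apply: pos_conj; exact: pos1. Qed.
Lemma pos_Mstar c : pos (c * star c).
Proof. by have := pos_starM (star c); rewrite starK. Qed.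

Lemma ple_ip a b u : ple a b -> ip (a u) u <= ip (b u) u.
Proof. by move=> /(pos_ip u); rewrite bopE ipBl subr_ge0. Qed.
Lemma ple_trans b a c : ple a b -> ple b c -> ple a c.
Proof. by move=> ab bc; rewrite /ple -(subrKA b); exact: posD. Qed.
Lemma ple_conj a b c : ple a b -> ple (star c * a * c) (star c * b * c).
Proof. by move=> /pos_conj h; rewrite /ple -mulrBl -mulrBr. Qed.

Lemma opbW r s (a : H -> H) : r <= s -> opb r a -> opb s a.
Proof. by move=> rs h u; apply: le_trans (h u) _; rewrite ler_wpM2r ?nm_ge0. Qed.
Lemma opbD r s a b : opb r a -> opb s b -> opb (r + s) (a + b).
Proof. by move=> ha hb u; rewrite bopE mulrDl; apply: le_trans (nmD _ _) _; apply: lerD. Qed.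
Lemma opbZ r s a : opb s a -> opb (`|r| * s) (r *: a).
Proof. by move=> ha u; rewrite bopE nmZ -mulrA ler_wpM2l. Qed.
Lemma opbN s a : opb s a -> opb s (- a).
Proof. by move=> ha u; rewrite bopE nmN. Qed.
Lemma opbM r s a b : 0 <= r -> opb r a -> opb s b -> opb (r * s) (a * b).
Proof.
move=> r0 ha hb u; rewrite bopE; apply: le_trans (ha _) _.
by rewrite -mulrA ler_wpM2l.
Qed.
Lemma opb_ip r a u v : opb r a -> `|ip (a u) v| <= r * (nm u * nm v).
Proof.
move=> ha; apply: le_trans (ip_norm_le _ _) _.
by rewrite mulrA ler_wpM2r ?nm_ge0.
Qed.
Lemma opb_star r a : 0 <= r -> opb r a -> opb r (star a).
Proof.
move=> r0 ha u; have [->|b0] := eqVneq (star a u) 0; first by rewrite nm0 mulr_ge0 ?nm_ge0.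
have p0 : 0 < nm (star a u) by rewrite lt0r nm_eq0 b0 nm_ge0.
rewrite -(ler_pM2r p0) -expr2 -ipuu -starE; apply: le_trans (cauchy_schwarz _ _) _.
by rewrite mulrAC ler_wpM2r ?nm_ge0.
Qed.
Lemma opb_eq0 a : (forall e, 0 < e -> opb e a) -> a = 0.
Proof.
move=> h; apply: bopext => u; apply/eqP; rewrite -nm_eq0 eq_le nm_ge0 andbT.
apply: le0_of_eps => e e0.
have h1 : 0 < nm u + 1 by rewrite ltr_pwDr ?nm_ge0.
apply: le_trans (h _ (divr_gt0 e0 h1) u) _.
by rewrite mulrAC ler_pdivrMr // ler_wpM2l ?ltW // ltrDl.
Qed.

(** Polarisation and the parallelogram law bound [4 * ip (a w) v] by
    [2 * r * (nm w ^+ 2 + nm v ^+ 2)]. The multiples [w] of [u] and [v] of [a u] are scaled to equal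
    norm, which loses nothing in this bound. *)
Lemma sa_opb r a : selfadj a -> (forall u, `|ip (a u) u| <= r * nm u ^+ 2) -> opb r a.
Proof.
move=> sa h u.
have [->|b0] := eqVneq (a u) 0.
  rewrite nm0; have [->|u0] := eqVneq u 0; first by rewrite nm0 mulr0.
  have p0 : 0 < nm u by rewrite lt0r nm_eq0 u0 nm_ge0.
  by rewrite -(pmulr_lge0 _ p0) -mulrA -expr2; apply: le_trans (h u).
have p0 : 0 < nm (a u) by rewrite lt0r nm_eq0 b0 nm_ge0.
have [u0|u0] := eqVneq u 0; first by rewrite u0 bop0 nm0 ltxx in p0.
have q0 : 0 < nm u by rewrite lt0r nm_eq0 u0 nm_ge0.
pose v := (nm u)%:C *: a u; pose w := (nm (a u))%:C *: u.
have h1 := h (w + v); have h2 := h (w - v).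
move: h1; rewrite ler_norml => /andP[_ h1].
move: h2; rewrite ler_norml => /andP[h2 _].
have polar x y : ip (a (x + y)) (x + y) - ip (a (x - y)) (x - y) = 4 * ip (a x) y.
  rewrite !bopB !bopD !(ipDl, ipDr, ipBl, ipBr, ipNl, ipNr).
  have -> : ip (a y) x = ip (a x) y by rewrite starE sa ipC.
  by ring.
have par x y : nm (x + y) ^+ 2 + nm (x - y) ^+ 2 = 2 * (nm x ^+ 2 + nm y ^+ 2).
  by rewrite -!ipuu !(ipDl, ipDr, ipBl, ipBr, ipNl, ipNr) (ipC y x); ring.
have : 4 * ip (a w) v <= r * (2 * (nm w ^+ 2 + nm v ^+ 2)).
  by rewrite -polar -par; lra.
rewrite /v /w bopZ ipZl ipZr ipuu !nmZ !ger0_norm ?nm_ge0 // => h3.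
suff : (4 * (nm u * nm (a u) ^+ 2)) * nm (a u) <= (4 * (nm u * nm (a u) ^+ 2)) * (r * nm u).
  by rewrite ler_pM2l // mulr_gt0 // mulr_gt0 // exprn_gt0.
by move: h3; rewrite [X in X <= _ -> _](_ : _ = 4 * (nm u * nm (a u) ^+ 2) * nm (a u)); 
  [move=> /le_trans; apply; rewrite le_eqVlt; apply/orP; left; apply/eqP; ring | ring].
Qed.

Lemma opb_ple r a : selfadj a -> opb r a -> ple a r%:B.
Proof.
move=> sa ha; split; first by rewrite /selfadj starB starZ star1 sa.
move=> u; rewrite !bopE ipBl ipZl ipuu subr_ge0; have := opb_ip u u ha.
by rewrite ler_norml -expr2 => /andP[].
Qed.

Lemma contr_opb a : ple (star a * a) 1 -> opb 1 a.
Proof.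
move=> h u; rewrite mul1r -(ler_pXn2r (ltn0Sn 1)) ?nnegrE ?nm_ge0 // -!ipuu.
by have := ple_ip u h; rewrite !bopE [X in X <= _]ipC -starE.
Qed.

Lemma opb_contr a : opb 1 a -> ple (star a * a) 1.
Proof.
move=> h; split; first by rewrite /selfadj starB starM starK star1.
move=> u; rewrite !bopE ipBl subr_ge0 [X in X <= _]ipC -starE !ipuu.
by rewrite ler_pXn2r ?nnegrE ?nm_ge0 //; have := h u; rewrite mul1r.
Qed.

(** The order bound amounts to [nm (a u) <= nm u], and norm bounds pass to the adjoint. *)
Lemma contr_star a : ple (star a * a) 1 -> ple (a * star a) 1.
Proof.
move=> /contr_opb /(opb_star ler01) /opb_contr.
by rewrite starK.
Qed.

Lemma bop_complete (x : nat -> bop H) :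
  (forall e : R, 0 < e -> exists N, forall m n, (N <= m)%N -> (N <= n)%N -> opb e (x m - x n)) ->
  exists l : bop H, forall e : R, 0 < e -> exists N, forall n, (N <= n)%N -> opb e (x n - l).
Proof.
move=> cx.
have /choice [l hl] : forall u, exists l, forall e : R, 0 < e ->
    exists N, forall n, (N <= n)%N -> nm (x n u - l) <= e.
  move=> u; apply: seq_cvg => e e0.
  have h1 : 0 < nm u + 1 by rewrite ltr_pwDr ?nm_ge0.
  have [N HN] := cx _ (divr_gt0 e0 h1); exists N => m n mN nN.
  rewrite -bopBE; apply: le_trans (HN m n mN nN u) _.
  by rewrite mulrAC ler_pdivrMr // ler_wpM2l ?ltW // ltrDl.
have eql e u : 0 < e -> exists N, forall n, (N <= n)%N -> nm (x n u - l u) <= e * nm u.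
  move=> e0; have [N HN] := cx _ e0; exists N => n Nn.
  rewrite -subr_le0; apply: le0_of_eps => d d0.
  have [M HM] := hl u _ d0.
  have h1 := HN n (maxn N M) Nn (leq_maxl _ _) u; have h2 := HM _ (leq_maxr N M).
  rewrite bopBE in h1.
  have := nmD (x n u - x (maxn N M) u) (x (maxn N M) u - l u); rewrite subrKA.
  by lra.
have limP (u v : H) : (forall e : R, 0 < e -> nm (u - v) <= e) -> u = v.
  move=> h; apply/eqP; rewrite -subr_eq0 -nm_eq0 eq_le nm_ge0 andbT.
  exact: le0_of_eps.
have bl : bounded_op l.
  apply: bounded_opW.
    move=> z u v.
    apply: limP => e e0.
    have [C C0 hC] := bop_opb (bscale z (1 : bop H)).
    have e1 : 0 < e / 3 by rewrite divr_gt0.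
    have [N1 H1] := hl u _ (divr_gt0 e1 C0).
    have [N2 H2] := hl v _ e1.
    have [N3 H3] := hl (z *: u + v) _ e1.
    pose n := maxn N1 (maxn N2 N3).
    have {}H1 : nm (x n u - l u) <= e / 3 / C by apply: H1; rewrite leq_max leqnn.
    have {}H2 : nm (x n v - l v) <= e / 3 by apply: H2; rewrite !leq_max leqnn !orbT.
    have {}H3 : nm (x n (z *: u + v) - l (z *: u + v)) <= e / 3.
      by apply: H3; rewrite !leq_max leqnn !orbT.
    have -> : l (z *: u + v) - (z *: l u + l v) =
      - (x n (z *: u + v) - l (z *: u + v)) + (z *: (x n u - l u) + (x n v - l v)).
      by rewrite bopD bopZC scalerBr opprB [X in _ = _ + X]addrACA -opprD subrKA.
    apply: le_trans (nmD _ _) _; rewrite nmN.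
    have h4 := nmD (z *: (x n u - l u)) (x n v - l v).
    have h5 : nm (z *: (x n u - l u)) <= e / 3.
      apply: le_trans (hC _) _; by rewrite mulrC -ler_pdivlMr.
    lra.
  have [N HN] := cx 1 ltr01.
  have [C C0 hC] := bop_opb (x N).
  exists (C + 2) => u.
  have [M HM] := eql 1 u ltr01.
  have h1 := HN N (maxn N M) (leqnn _) (leq_maxl _ _) u; have h2 := HM _ (leq_maxr N M).
  rewrite bopBE nmBC in h1; rewrite nmBC in h2.
  have := nmD (x N u) (l u - x N u); rewrite addrC subrK.
  have := nmD (l u - x (maxn N M) u) (x (maxn N M) u - x N u); rewrite subrKA.
  by have := hC u; lra.
exists (Bop bl) => e e0.
have e2 : 0 < e / 2 by rewrite divr_gt0.
have [N HN] := cx _ e2; exists N => n Nn u.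
have [M HM] := eql _ u e2.
have h1 := HN n (maxn N M) Nn (leq_maxl _ _) u; have h2 := HM _ (leq_maxr N M).
rewrite bopBE in h1.
have := nmD (x n u - x (maxn N M) u) (x (maxn N M) u - l u); rewrite subrKA bopBE /=.
by lra.
Qed.

Definition invertible a := exists b, b * a = 1 /\ a * b = 1.

(** [lax_milgram] solves [a l = w]; coercivity gives injectivity and bounds the inverse by
    [m^-1]. *)
Lemma coercive_invertible a m : 0 < m -> selfadj a ->
  (forall u, m * nm u ^+ 2 <= ip (a u) u) -> invertible a.
Proof.
move=> m0 sa am; have [C C0 hC] := bop_opb a.
have /choice [b hb] w : exists l, forall v, ip (a l) v = ip w v.
  apply: (@lax_milgram _ _ a (ip w) m C (nm w)) => //.
  - exact: bopD.
  - exact: bopZ.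
  - by move=> u v; rewrite starE sa.
  - by move=> u v; rewrite ipDr.
  - by move=> r u; rewrite ipZr.
  - by move=> u; exact: ip_norm_le.
have ab w : a (b w) = w by apply: ip_eq => v; rewrite hb.
have ainj u v : a u = a v -> u = v.
  move=> e; apply/eqP; rewrite -subr_eq0 -nm_eq0 -sqrf_eq0 eq_le sqr_ge0 andbT.
  by rewrite -(pmulr_rle0 _ m0); apply: le_trans (am _) _; rewrite bopB e subrr ip0l.
have bb : bounded_op b.
  apply: bounded_opW.
    by move=> z u v; apply: ainj; rewrite bopD bopZC !ab.
  exists m^-1 => w; rewrite mulrC ler_pdivlMr //.
  have [->|b0] := eqVneq (b w) 0; first by rewrite nm0 mul0r nm_ge0.
  have p0 : 0 < nm (b w) by rewrite lt0r nm_eq0 b0 nm_ge0.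
  rewrite -(ler_pM2r p0) mulrAC -expr2 mulrC.
  by apply: le_trans (am _) _; rewrite ab; exact: cauchy_schwarz.
by exists (Bop bb); split; apply: bopext => u; rewrite /= ?ab //; apply: ainj; rewrite ab.
Qed.

End Star.
Arguments star {R H} a%_ring_scope.

(** * Polynomial calculus *)

Section PolynomialCalculus.
Context {R : realType} {H : hilbertType R}.
Implicit Types (u v w : H) (r : R) (a b c : bop H) (P Q : {poly R}).

Definition peval a P : bop H := \sum_(i < size P) P`_i *: a ^+ i.

Lemma pevalE n a P : (size P <= n)%N -> peval a P = \sum_(i < n) P`_i *: a ^+ i.
Proof.
move=> h; rewrite /peval (big_ord_widen n (fun i => P`_i *: a ^+ i)) //.
rewrite big_mkcond; apply: eq_bigr => i _; case: ltnP => // si.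
by rewrite nth_default // scale0r.
Qed.

Lemma pevalD a P Q : peval a (P + Q) = peval a P + peval a Q.
Proof.
pose n := maxn (size P) (size Q).
rewrite !(@pevalE n) ?leq_maxl ?leq_maxr ?size_polyD // -big_split /=.
by apply: eq_bigr => i _; rewrite coefD scalerDl.
Qed.

Lemma pevalZ a r P : peval a (r *: P) = r *: peval a P.
Proof.
rewrite !(@pevalE (size P)) ?size_scale_leq // scaler_sumr.
by apply: eq_bigr => i _; rewrite coefZ scalerA.
Qed.

Lemma pevalN a P : peval a (- P) = - peval a P.
Proof. by rewrite -scaleN1r pevalZ scaleN1r. Qed.

Lemma pevalB a P Q : peval a (P - Q) = peval a P - peval a Q.
Proof. by rewrite pevalD pevalN. Qed.

Lemma pevalC a r : peval a r%:P = r%:B.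
Proof.
rewrite (@pevalE 1) ?size_polyC_leq1 // big_ord1 coefC eqxx.
by rewrite expr0.
Qed.

Lemma pevalMX a P : peval a (P * 'X) = peval a P * a.
Proof.
rewrite (@pevalE (size P).+1); last first.
  by apply: leq_trans (size_polyMleq _ _) _; rewrite size_polyX addnC.
rewrite big_ord_recl coefMX /= scale0r add0r /peval mulr_suml.
by apply: eq_bigr => i _; rewrite coefMX /= bscalerAl exprSr.
Qed.

Lemma pevalX a : peval a 'X = a.
Proof. by rewrite -['X]mul1r pevalMX pevalC scale1r mul1r. Qed.

Lemma peval0 a : peval a 0 = 0.
Proof. by rewrite -(scale0r 1) pevalZ scale0r. Qed.

Lemma pevalM a P Q : peval a (P * Q) = peval a P * peval a Q.
Proof.
elim/poly_ind: Q => [|Q r IH]; first by rewrite mulr0 peval0 mulr0.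
rewrite mulrDr mulrA !pevalD !pevalMX IH mulrDr mulrA; congr (_ + _).
by rewrite mulrC mul_polyC pevalZ pevalC bscalerAr mulr1.
Qed.

Lemma peval_comm a c P : c * a = a * c -> c * peval a P = peval a P * c.
Proof.
move=> h; elim/poly_ind: P => [|P r IH].
  by rewrite peval0 mulr0 mul0r.
rewrite pevalD pevalMX pevalC mulrDl mulrDr mulrA IH -!mulrA h.
by rewrite bscalerAr bscalerAl mulr1 mul1r.
Qed.

Lemma peval_star a P : star (peval a P) = peval (star a) P.
Proof.
elim/poly_ind: P => [|P r IH].
  by rewrite !peval0 star0.
rewrite !pevalD !pevalMX !pevalC starD starM starZ star1 IH.
by rewrite (@peval_comm (star a) (star a)).
Qed.

Lemma peval_sa a P : selfadj a -> selfadj (peval a P).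
Proof. by rewrite /selfadj peval_star => ->. Qed.

Lemma iterE a n u : iter n a u = (a ^+ n) u.
Proof. by elim: n => [//|n IH]; rewrite iterS IH exprS. Qed.

Lemma poly_opE a P : poly_op P a = peval a P.
Proof.
apply/funext => u; rewrite /poly_op /peval.
rewrite (big_morph (fun b : bop H => b u) (id1 := 0) (op1 := +%R)) //.
by apply: eq_bigr => i _; rewrite iterE.
Qed.

Lemma invertibleM a b : invertible a -> invertible b -> invertible (a * b).
Proof.
move=> [a' [a1 a2]] [b' [b1 b2]]; exists (b' * a'); split.
  by rewrite -mulrA (mulrA a') a1 mul1r.
by rewrite -mulrA (mulrA b) b2 mul1r.
Qed.

Lemma spectrumE a (t : R) : spectrum a t%:C <-> ~ invertible (a - t%:B).
Proof.
have e : bfun a - t%:C *: idfun = bfun (a - t%:B).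
  by apply/funext => u; rewrite !bopE.
rewrite /spectrum /= e; split=> h1 h2; apply: h1.
  have [b [b1 b2]] := h2; exists b; split; first exact: bopP.
    exact: (congr1 (@bfun R H) b1).
  exact: (congr1 (@bfun R H) b2).
by have [b [pb b1 b2]] := h2; exists (Bop pb); split; apply: bop_eq.
Qed.

Lemma invertible_scalar r : r != 0 -> invertible (r%:B : bop H).
Proof.
by move=> r0; exists (r^-1)%:B; rewrite !bscalerAl !mul1r !scalerA mulVf ?mulfV // !scale1r.
Qed.

Lemma selfadjB a b : selfadj a -> selfadj b -> selfadj (a - b).
Proof. by rewrite /selfadj starB => -> ->. Qed.
Lemma selfadj_scalar r : selfadj (r%:B : bop H).
Proof. by rewrite /selfadj starZ star1. Qed.
Lemma selfadj_subs a r : selfadj a -> selfadj (a - r%:B).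
Proof. by move=> /selfadjB; apply; exact: selfadj_scalar. Qed.

(* A nonreal root [x + i y] of [P] contributes the factor [('X - x)^2 + y^2],
   which is coercive at a self-adjoint operator. *)
Lemma peval_invertible a P : selfadj a -> P != 0 ->
  (forall t : R, ~ invertible (a - t%:B) -> P.[t] != 0) -> invertible (peval a P).
Proof.
move=> sa; have [n] := ubnP (size P); elim: n P => // n IH P; rewrite ltnS => sP P0 hP.
have [s1|s1] := leqP (size P) 1.
  rewrite (size1_polyC s1) pevalC; apply: invertible_scalar.
  by move: P0; rewrite {1}(size1_polyC s1) polyC_eq0.
pose C := (R[i] : closedFieldType).
pose f : {rmorphism R -> C} := real_complex R.
have /closed_rootP [[x y] rP] : size (map_poly f P) != 1%N by rewrite size_map_poly gtn_eqF.
have [y0|y0] := eqVneq y 0.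
  have : root P x.
    by rewrite -(fmorph_root f); move: rP; rewrite y0.
  move=> rPx; have [Q eQ] := factor_theorem P x rPx.
  have Q0 : Q != 0 by apply: contraNneq P0 => Q0; rewrite eQ Q0 mul0r.
  rewrite eQ pevalM; apply: invertibleM.
    apply: IH => //.
      by move: sP; rewrite eQ size_Mmonic ?monicXsubC // size_XsubC addn2.
    by move=> t /hP; rewrite eQ hornerM mulf_eq0 negb_or => /andP[].
  rewrite pevalB pevalX pevalC; apply: contrapT => /hP.
  by rewrite -[_ == 0]/(root P x) rPx.
pose q := ('X - x%:P) ^+ 2 + (y ^+ 2)%:P.
have sq : size q = 3%N.
  rewrite /q size_polyDl size_exp_XsubC // ltnS (leq_trans (size_polyC_leq1 _)) //.
have q0 : q != 0 by rewrite -size_poly_eq0 sq.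
have rq : root (map_poly f q) (x +i* y : C).
  rewrite /q rmorphD rmorphXn rmorphB /= map_polyX !map_polyC /= rootE !hornerE /=.
  by apply/eqP; simpc; congr Complex; ring.
(* The remainder modulo [q] is real, of degree at most 1, and vanishes at the nonreal number
   [x +i* y], so it is 0. *)
have dq : dvdp q P.
  have sr : (size (modp P q) <= 2)%N by have := ltn_modp P q; rewrite q0 sq ltnS.
  have rr : root (map_poly f (modp P q)) (x +i* y : C).
    move: rP; rewrite {1}(divp_eq P q) rmorphD rmorphM /= !rootE hornerD hornerM.
    by move: rq; rewrite rootE => /eqP ->; rewrite mulr0 add0r.
  have er : modp P q = ((modp P q)`_1)%:P * 'X + ((modp P q)`_0)%:P.
    apply/polyP => -[|[|i]]; rewrite coefD coefMX !coefC /= ?add0r ?addr0 //.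
    by rewrite nth_default // (leq_trans sr).
  move: rr; rewrite er rmorphD rmorphM /= map_polyX !map_polyC /= rootE !hornerE /=.
  simpc => /eqP [e0 e1].
  have r1 : (modp P q)`_1 = 0.
    by apply/eqP; move/eqP: e1; rewrite mulf_eq0 (negbTE y0) orbF.
  by rewrite /dvdp er r1 mul0r add0r; move: e0; rewrite r1 !mul0r add0r => ->.
have eP : P = divp P q * q by rewrite divpK.
have Q0 : divp P q != 0 by apply: contraNneq P0 => Q0; rewrite eP Q0 mul0r.
rewrite eP pevalM; apply: invertibleM.
  apply: IH => //.
    by rewrite size_divp // sq; apply: leq_trans sP; rewrite ltn_subrL /= (ltn_trans _ s1).
  by move=> t /hP; rewrite {1}eP hornerM mulf_eq0 negb_or => /andP[].
apply: (@coercive_invertible _ _ _ (y ^+ 2)); first by rewrite exprn_even_gt0.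
  exact: peval_sa.
move=> u; rewrite /q pevalD expr2 pevalM !pevalB !pevalX !pevalC bopDE ipDl bopZE bop1E ipZl ipuu.
rewrite lerDr bopME starE (selfadj_subs _ sa) ipuu; exact: sqr_ge0.
Qed.

(** Expand [0 <= ip (s v) v] at [v = u - B^-1 (s u)] and bound the last term by [opb B s]. *)
Lemma pos_sqr_le s B u : 0 < B -> pos s -> opb B s -> nm (s u) ^+ 2 <= B * ip (s u) u.
Proof.
move=> B0 ps hs; have := pos_ip (u - (B^-1)%:C *: s u) ps.
rewrite bopB bopZ !(ipBl, ipBr, ipZl, ipZr).
have -> : ip (s (s u)) u = nm (s u) ^+ 2 by rewrite starE (pos_sa ps) ipuu.
rewrite ipuu => h.
have := opb_ip (s u) (s u) hs; rewrite ler_norml => /andP[_ h2].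
rewrite -ler_pdivrMl //.
have h3 : B^-1 * (B^-1 * ip (s (s u)) (s u)) <= B^-1 * nm (s u) ^+ 2.
  rewrite ler_pM2l ?invr_gt0 // ler_pdivrMl //.
by lra.
Qed.

(** The infimum [m] of the form on the unit sphere is a spectral value: by [pos_sqr_le], unit
    vectors that nearly attain it make [s u] small for [s = b - m], whereas an inverse of norm at
    most [K] forces [1 <= K * nm (s u)]. The vector [u0] makes the sphere nonempty. *)
Lemma numerical_range_inf b u0 : selfadj b -> u0 != 0 ->
  exists m : R, (forall u, m * nm u ^+ 2 <= ip (b u) u) /\ ~ invertible (b - m%:B).
Proof.
move=> sb u00; have [B0 B0p hB0] := bop_opb b.
pose S := [set ip (b u) u | u in [set u | nm u = 1]].
have unit u : u != 0 -> nm ((nm u)^-1%:C *: u) = 1.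
  move=> un; have p0 : 0 < nm u by rewrite lt0r nm_eq0 un nm_ge0.
  by rewrite nmZ ger0_norm ?invr_ge0 ?ltW // mulVf ?gt_eqF.
have hi : has_inf S.
  split.
    pose v := (nm u0)^-1%:C *: u0.
    by exists (ip (b v) v), v => //=; exact: unit.
  exists (- B0) => _ [u /= u1 <-].
  by have := opb_ip u u hB0; rewrite u1 !mulr1 ler_norml => /andP[].
exists (inf S); set m := inf S.
have mle u : m * nm u ^+ 2 <= ip (b u) u.
  have [->|un] := eqVneq u 0; first by rewrite nm0 expr0n mulr0 ip0r.
  have p0 : 0 < nm u by rewrite lt0r nm_eq0 un nm_ge0.
  have : m <= ip (b ((nm u)^-1%:C *: u)) ((nm u)^-1%:C *: u).
    by apply: ge_inf; [case: hi | exists ((nm u)^-1%:C *: u) => //=; exact: unit].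
  by rewrite bopZ ipZl ipZr mulrA mulrC -invfM ler_pdivlMr ?mulr_gt0 // -expr2.
split=> // -[c [c1 c2]].
pose s := b - m%:B.
have ps : pos s.
  split; first exact: selfadj_subs.
  by move=> u; rewrite !bopE ipBl ipZl ipuu subr_ge0.
have [K K0 hK] := bop_opb c.
have [B Bp hB] := bop_opb s.
have e0 : 0 < (K ^+ 2 * B)^-1 by rewrite invr_gt0 mulr_gt0 // exprn_gt0.
have [_ [u /= u1 <-]] := inf_adherent e0 hi.
apply/negP; rewrite -leNgt -/m -lerBrDl.
have -> : ip (b u) u - m = ip (s u) u by rewrite !bopE ipBl ipZl ipuu u1 expr1n mulr1.
rewrite invfM ler_pdivrMr // mulrC -(ler_pM2l (exprn_gt0 2 K0)).
rewrite mulfV ?gt_eqF ?exprn_gt0 //.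
have h1 := pos_sqr_le u Bp ps hB.
have : 1 <= K * nm (s u) by rewrite -u1 -{1}[u]bop1E -c1 bopME; exact: hK.
rewrite -(ler_pXn2r (ltn0Sn 1)) ?nnegrE ?mulr_ge0 ?nm_ge0 ?(ltW K0) // expr1n exprMn => h2.
by apply: le_trans h2 _; rewrite ler_pM2l ?exprn_gt0.
Qed.

(** If the form of [peval a P] were negative somewhere, its infimum [m < 0] would be a spectral
    value of [peval a P]; but [P - m] has no zero on the spectrum of [a], so [peval_invertible]
    applies to it. *)
Lemma peval_pos a P : selfadj a ->
  (forall t : R, ~ invertible (a - t%:B) -> 0 <= P.[t]) -> pos (peval a P).
Proof.
move=> sa hP; split; first exact: peval_sa.
move=> u0; rewrite leNgt; apply/negP => hu0.
have u00 : u0 != 0 by apply/eqP => e; move: hu0; rewrite e ip0r ltxx.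
have [m [mle ninv]] := numerical_range_inf (peval_sa P sa) u00.
have m0 : m < 0.
  have := le_lt_trans (mle u0) hu0; rewrite pmulr_llt0 // exprn_gt0 //.
  by rewrite lt0r nm_eq0 u00 nm_ge0.
apply: ninv; rewrite -(pevalC a) -pevalB; apply: peval_invertible => //.
  (* [P - m] is not the zero polynomial: the spectrum of [a] is nonempty, and [P] is nonnegative
     there. *)
  apply/eqP => e; have [t [_ /hP]] := numerical_range_inf sa u00.
  have : P.[t] - m = 0 by rewrite -[m](hornerC _ t) -hornerN -hornerD e horner0.
  by lra.
by move=> t /hP; rewrite hornerD hornerN hornerC => h; apply/eqP; lra.
Qed.

(** Apply [peval_pos] to [e - P] and [e + P]. *)
Lemma peval_opb a P e : selfadj a -> 0 <= e ->
  (forall t : R, ~ invertible (a - t%:B) -> `|P.[t]| <= e) -> opb e (peval a P).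
Proof.
move=> sa e0 hP; apply: sa_opb => [|u]; first exact: peval_sa.
have h1 : pos (peval a (e%:P - P)).
  apply: peval_pos => // t /hP; rewrite ler_norml hornerD hornerN hornerC => /andP[? ?].
  by lra.
have h2 : pos (peval a (e%:P + P)).
  apply: peval_pos => // t /hP; rewrite ler_norml hornerD hornerC => /andP[? ?].
  by lra.
have := pos_ip u h1; have := pos_ip u h2.
rewrite pevalB pevalD !pevalC !bopE ipBl ipDl ipZl ipuu ler_norml.
by move=> ? ?; apply/andP; split; lra.
Qed.

Definition fc_spec (f : R -> R) (a : H -> H) : set (H -> H) :=
  [set b | bounded_op b /\ forall e : R, 0 < e -> exists P : {poly R},
    (forall t : R, spectrum a t%:C -> `|P.[t] - f t| <= e) /\
    (forall u, `|poly_op P a u - b u| <= e%:C * `|u|)].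

(** Two polynomials close to [f] on the spectrum are close to each other there, hence close as
    operators by [peval_opb]. *)
Lemma fc_spec_uniq f a (b c : bop H) : selfadj a ->
  fc_spec f a b -> fc_spec f a c -> b = c.
Proof.
move=> sa [_ hb] [_ hc]; apply/eqP; rewrite -subr_eq0; apply/eqP/opb_eq0 => e e0.
have e4 : 0 < e / 4 by rewrite divr_gt0.
have [P [P1 P2]] := hb _ e4; have [Q [Q1 Q2]] := hc _ e4.
have h1 : opb (e / 4) (peval a P - b).
  by move=> u; have := P2 u; rewrite (normE u) normE -(rmorphM (real_complex R)) lecR poly_opE bopBE.
have h2 : opb (e / 4) (peval a Q - c).
  by move=> u; have := Q2 u; rewrite (normE u) normE -(rmorphM (real_complex R)) lecR poly_opE bopBE.
have h3 : opb (e / 2) (peval a (P - Q)).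
  apply: peval_opb => //; first by lra.
  move=> t /spectrumE ht; have := P1 t ht; have := Q1 t ht.
  rewrite !ler_norml hornerD hornerN => /andP[? ?] /andP[? ?].
  by apply/andP; split; lra.
have -> : b - c = peval a (P - Q) - (peval a P - b) + (peval a Q - c).
  by rewrite pevalB opprB [X in _ = X + _]addrC !subrKA.
have -> : e = e / 2 + e / 4 + e / 4 by field.
by apply: opbD => //; apply: opbD => //; apply: opbN.
Qed.

Lemma fun_calculusE f a (b : bop H) : selfadj a -> fc_spec f a b -> fun_calculus f a = b.
Proof.
move=> sa hb; rewrite /fun_calculus -/(fc_spec f a).
have h : fc_spec f a (xget 0 (fc_spec f a)) by case: xgetP => // /(_ _ hb).
exact: (congr1 (@bfun R H) (@fc_spec_uniq f a (Bop h.1) b sa h hb)).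
Qed.

(** For [t < 0] the operator [a - t] is coercive, and for [t > C] the operator [t - a] is. *)
Lemma spec_bounds a (C t : R) : 0 <= C -> pos a -> opb C a ->
  ~ invertible (a - t%:B) -> 0 <= t <= C.
Proof.
move=> C0 pa ha; apply: contra_notT; rewrite negb_and -!ltNge => /orP[t0|tC].
  apply: (@coercive_invertible _ _ _ (- t)); first by rewrite oppr_gt0.
    exact/selfadj_subs/pos_sa.
  move=> u; rewrite !bopE ipBl ipZl ipuu; have := pos_ip u pa.
  by rewrite mulNr => h; lra.
have [b [b1 b2]] : invertible (t%:B - a).
  apply: (@coercive_invertible _ _ _ (t - C)); first by rewrite subr_gt0.
    by apply: selfadjB; [exact: selfadj_scalar|exact: pos_sa].
  move=> u; rewrite !bopE ipBl ipZl ipuu; have := opb_ip u u ha.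
  rewrite ler_norml -expr2 => /andP[_] h; rewrite mulrBl; lra.
exists (- b); rewrite -opprB mulrNN b1 mulNr mulrN opprK b2 //.
Qed.

End PolynomialCalculus.

(** * Uniform approximation by polynomials *)

Section Weierstrass.
Context {R : realType}.
Implicit Types (f g : R -> R) (C e t s : R).

(* Evaluated at [t], [bernstein n g] is the mean of [g] under the binomial law
   with parameters [n] and [t]. *)
Fixpoint bernstein (n : nat) (g : nat -> R) : {poly R} :=
  if n is m.+1 then 'X * bernstein m (g \o S) + (1 - 'X) * bernstein m g
  else (g 0%N)%:P.

Lemma bernstein_le n (g h : nat -> R) t : 0 <= t <= 1 ->
  (forall k, (k <= n)%N -> g k <= h k) -> (bernstein n g).[t] <= (bernstein n h).[t].
Proof.
move=> /andP[t0 t1]; elim: n g h => [|n IH] g h gh /=; first by rewrite !hornerC gh.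
rewrite !(hornerD, hornerM, hornerN, hornerX, hornerC).
apply: lerD; apply: ler_wpM2l; rewrite ?subr_ge0 //; apply: IH => k kn.
  exact: (gh k.+1).
exact/gh/leqW.
Qed.

(** The second moment of the binomial law about [z] is squared bias plus variance. Conditioning on
    the first trial shifts [z] to [z - 1] in case of success. *)
Lemma bernstein_quadratic n (x y z t : R) :
  (bernstein n (fun k => x + y * (k%:R - z) ^+ 2)).[t] =
  x + y * ((n%:R * t - z) ^+ 2 + n%:R * (t * (1 - t))).
Proof.
elim: n z => [|n IH] z /=; first by rewrite hornerC !mul0r addr0.
rewrite !(hornerD, hornerM, hornerN, hornerX, hornerC) IH.
have -> : (fun k => x + y * (k%:R - z) ^+ 2) \o S = (fun k => x + y * (k%:R - (z - 1)) ^+ 2).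
  by apply/funext => k /=; rewrite -natr1; congr (_ + _ * _ ^+ 2); ring.
by rewrite IH -natr1; ring.
Qed.

Definition uc C f := (exists M, forall t, 0 <= t <= C -> `|f t| <= M) /\
  forall e, 0 < e -> exists2 d : R, 0 < d &
    forall s t, 0 <= s <= C -> 0 <= t <= C -> `|s - t| <= d -> `|f s - f t| <= e.

Definition papprox C f := forall e, 0 < e ->
  exists P : {poly R}, forall t, 0 <= t <= C -> `|P.[t] - f t| <= e.

(** Bernstein's proof: uniform continuity near [t] and boundedness away from it bound [|f s - f t|]
    by [e / 2] plus a multiple of [(s - t)^2]. Taking binomial means leaves [e / 2] plus a multiple
    of the variance of the rescaled law, which is of order [1 / n]. *)
Theorem weierstrass C f : 0 < C -> uc C f -> papprox C f.
Proof.
move=> C0 [[M hM] hf] e e0.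
have e2 : 0 < e / 2 by rewrite divr_gt0.
have [d d0 hd] := hf _ e2.
have M0 : 0 <= M by apply: le_trans (hM 0 _) => //; rewrite lexx ltW.
have key s t : 0 <= s <= C -> 0 <= t <= C -> `|f s - f t| <= e / 2 + 2 * M / d ^+ 2 * (s - t) ^+ 2.
  move=> hs ht; have [sd|sd] := leP `|s - t| d.
    apply: le_trans (hd s t hs ht sd) _.
    by rewrite lerDl mulr_ge0 ?sqr_ge0 // divr_ge0 ?sqr_ge0 // mulr_ge0.
  have h1 : 1 <= (s - t) ^+ 2 / d ^+ 2.
    rewrite ler_pdivlMr ?exprn_gt0 // mul1r -[X in _ <= X]real_normK ?num_real //.
    by rewrite ler_pXn2r ?nnegrE ?normr_ge0 ?(ltW d0) // ltW.
  have h2 : `|f s - f t| <= 2 * M.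
    by apply: le_trans (ler_normB _ _) _; have := hM s hs; have := hM t ht; lra.
  apply: le_trans h2 _; apply: le_trans (_ : 2 * M * ((s - t) ^+ 2 / d ^+ 2) <= _).
    by rewrite ler_peMr // mulr_ge0.
  by rewrite [X in _ <= _ + X]mulrAC mulrA lerDr ltW.
have [n hn] : exists n, 2 * M / d ^+ 2 * C ^+ 2 * n.+1%:R^-1 <= e / 2.
  have K0 : 0 < 2 * M / d ^+ 2 * C ^+ 2 + 1.
    by rewrite ltr_wpDl // mulr_ge0 ?sqr_ge0 // divr_ge0 ?sqr_ge0 // mulr_ge0.
  have [n /(_ n (leqnn _)) hn] := archi_inv (divr_gt0 e2 K0).
  exists n; move: hn; rewrite ler_pdivlMr //; apply: le_trans.
  by rewrite mulrC ler_wpM2l ?invr_ge0 // lerDl.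
set N : R := n.+1%:R in hn.
have N0 : 0 < N by rewrite ltr0n.
exists (bernstein n.+1 (fun k => f (C * (k%:R / N))) \Po (C^-1 *: 'X)) => t /andP[t0 tC].
rewrite horner_comp hornerZ hornerX.
set u := C^-1 * t.
have u01 : 0 <= u <= 1.
  by rewrite mulr_ge0 ?invr_ge0 ?(ltW C0) // ler_pdivrMl // mulr1.
have tu : t = C * u by rewrite mulVKf // gt_eqF.
set B := 2 * M / d ^+ 2 * C ^+ 2.
have B0 : 0 <= B by rewrite mulr_ge0 ?sqr_ge0 // divr_ge0 ?sqr_ge0 // mulr_ge0.
have ptw k : (k <= n.+1)%N -> `|f (C * (k%:R / N)) - f t| <= e / 2 + B / N ^+ 2 * (k%:R - N * u) ^+ 2.
  move=> kn; have kN : 0 <= k%:R / N <= 1.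
    by rewrite divr_ge0 ?ler0n ?(ltW N0) //= ler_pdivrMr // mul1r ler_nat.
  apply: le_trans (key _ _ _ _) _.
  - by case/andP: kN => k0 k1; rewrite mulr_ge0 ?(ltW C0) //= -[X in _ <= X]mulr1 ler_wpM2l ?(ltW C0).
  - by rewrite t0.
  rewrite lerD2l le_eqVlt; apply/orP; left; apply/eqP.
  by rewrite tu /B; field; rewrite !gt_eqF.
have bnd : B / N ^+ 2 * (N * (u * (1 - u))) <= e / 2.
  apply: le_trans hn; rewrite -/B.
  have -> : B / N ^+ 2 * (N * (u * (1 - u))) = B * N^-1 * (u * (1 - u)) by field; rewrite gt_eqF.
  rewrite -[X in _ <= X]mulr1 ler_wpM2l ?(mulr_ge0 B0) ?invr_ge0 ?(ltW N0) //.
  by case/andP: u01 => u0 u1; rewrite mulr_ile1 // ?subr_ge0 // gerBl.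
have up := @bernstein_le n.+1 _ (fun k => (f t + e / 2) + B / N ^+ 2 * (k%:R - N * u) ^+ 2) u u01.
have lo := @bernstein_le n.+1 (fun k => (f t - e / 2) + (- (B / N ^+ 2)) * (k%:R - N * u) ^+ 2) _ u u01.
rewrite bernstein_quadratic -/N subrr expr0n add0r in up.
rewrite bernstein_quadratic -/N subrr expr0n add0r in lo.
rewrite ler_norml; apply/andP; split.
  rewrite lerBrDr; apply: le_trans (lo _ _); last first.
    move=> k /ptw; rewrite ler_norml => /andP[]; rewrite mulNr.
    by move: (f _) (_ * (_ - N * u) ^+ 2) => ? ?; lra.
  by rewrite mulNr; move: bnd; move: (_ * (N * _)) => ?; lra.
rewrite lerBlDr; apply: le_trans (up _ _) _; last by move: bnd; move: (_ * (N * _)) => ?; lra.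
by move=> k /ptw; rewrite ler_norml => /andP[]; move: (f _) (_ * (_ - N * u) ^+ 2) => ? ?; lra.
Qed.

Lemma lipschitz_uc C f (K : R) : 0 <= C -> 0 < K ->
  (forall s t, 0 <= s -> 0 <= t -> `|f s - f t| <= K * `|s - t|) -> uc C f.
Proof.
move=> C0 K0 hf; split.
  exists (`|f 0| + K * C) => t /andP[t0 tC].
  have := hf t 0 t0 (lexx _); rewrite subr0 (ger0_norm t0) => h.
  have := ler_normD (f t - f 0) (f 0); rewrite subrK => h'.
  have : K * t <= K * C by rewrite ler_pM2l.
  by lra.
move=> e e0; exists (e / K); first by rewrite divr_gt0.
move=> s t /andP[s0 _] /andP[t0 _] h; apply: le_trans (hf s t s0 t0) _.
by rewrite mulrC -ler_pdivlMr.
Qed.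

(** Let [k ^ r = 1 - e / D] and [t <= s]. If [t >= k s], then
    [t ^ r >= (1 - e / D) s ^ r >= s ^ r - e]. Otherwise [s - t > (1 - k) s], so a small difference
    forces [s ^ r <= e]. This covers [r < 1], where the function is not Lipschitz at 0. *)
Lemma powR_uc C (r : R) : 0 < C -> 0 < r -> uc C (fun t => t `^ r).
Proof.
move=> C0 r0; have rn : r != 0 by rewrite gt_eqF.
pose D := C `^ r; have D0 : 0 < D by rewrite powR_gt0.
have bd t : 0 <= t <= C -> t `^ r <= D.
  by case/andP=> t0 tC; rewrite ge0_ler_powR ?nnegrE // ?(ltW r0) // ltW.
split; first by exists D => t ht; rewrite ger0_norm ?powR_ge0 // bd.
move=> e e0; have [De|eD] := leP D e.
  exists 1 => // s t hs ht _; rewrite ler_norml.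
  by have := bd s hs; have := bd t ht; have := powR_ge0 s r; have := powR_ge0 t r; lra.
pose k := (1 - e / D) `^ r^-1.
have x0 : 0 <= 1 - e / D by rewrite subr_ge0 ler_pdivrMr // mul1r ltW.
have kr : k `^ r = 1 - e / D by rewrite -powRrM mulVf // powRr1.
have k0 : 0 <= k by exact: powR_ge0.
have k1 : k < 1.
  rewrite ltNge; apply/negP => k1.
  have : 1 `^ r <= k `^ r by rewrite ge0_ler_powR ?nnegrE ?(ltW r0).
  by rewrite powR1 kr lerBrDl gerDr leNgt divr_gt0.
have d0 : 0 < (1 - k) * e `^ r^-1 by rewrite mulr_gt0 ?subr_gt0 ?powR_gt0.
exists ((1 - k) * e `^ r^-1) => //.
have main s t : 0 <= t -> t <= s -> s <= C -> s - t <= (1 - k) * e `^ r^-1 -> s `^ r - t `^ r <= e.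
  move=> t0 ts sC h; have s0 : 0 <= s by exact: le_trans ts.
  have [kt|tk] := leP (k * s) t.
    have : (k * s) `^ r <= t `^ r by rewrite ge0_ler_powR ?nnegrE ?mulr_ge0 // ltW.
    rewrite powRM // kr => h1.
    have h2 : e / D * s `^ r <= e.
      by rewrite mulrAC ler_pdivrMr // ler_pM2l // bd // s0.
    by rewrite mulrBl mul1r in h1; lra.
  have h1 : (1 - k) * s <= (1 - k) * e `^ r^-1 by rewrite mulrBl mul1r; lra.
  rewrite ler_pM2l ?subr_gt0 // in h1.
  have : s `^ r <= (e `^ r^-1) `^ r by rewrite ge0_ler_powR ?nnegrE ?powR_ge0 // ltW.
  by rewrite -powRrM mulVf // powRr1 ?(ltW e0) //; have := powR_ge0 t r; lra.
move=> s t /andP[s0 sC] /andP[t0 tC]; wlog ts : s t s0 sC t0 tC / t <= s.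
  move=> W h; have [ts|st] := leP t s; first exact: W.
  by rewrite distrC; apply: W => //; [exact: ltW|rewrite distrC].
rewrite (ger0_norm (_ : 0 <= s - t)) ?subr_ge0 // => h.
rewrite ger0_norm ?subr_ge0; first exact: main.
by rewrite ge0_ler_powR ?nnegrE ?(ltW r0).
Qed.

Lemma papproxM C f g (K L : R) : papprox C f -> papprox C g ->
  (forall t, 0 <= t <= C -> `|f t| <= K) -> (forall t, 0 <= t <= C -> `|g t| <= L) ->
  papprox C (fun t => f t * g t).
Proof.
move=> hf hg fK gL e e0.
pose A := `|K| + `|L| + 1.
have A1 : 1 <= A by rewrite /A; have := normr_ge0 K; have := normr_ge0 L; lra.
have A0 : 0 < A by lra.
pose d := Num.min 1 (e / (3 * A)).
have d0 : 0 < d by rewrite lt_min ltr01 divr_gt0 // mulr_gt0.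
have dA : d * A <= e / 3.
  by rewrite -ler_pdivlMr // -mulrA -invfM ge_min lexx orbT.
have d1 : d <= 1 by rewrite ge_min lexx.
have [P hP] := hf d d0; have [Q hQ] := hg d d0.
exists (P * Q) => t ht; rewrite hornerM.
have -> : P.[t] * Q.[t] - f t * g t =
  (P.[t] - f t) * (Q.[t] - g t) + (P.[t] - f t) * g t + f t * (Q.[t] - g t) by ring.
have K' : `|f t| <= A.
  by apply: le_trans (fK t ht) _; rewrite /A; have := ler_norm K; have := normr_ge0 L; lra.
have L' : `|g t| <= A.
  by apply: le_trans (gL t ht) _; rewrite /A; have := ler_norm L; have := normr_ge0 K; lra.
apply: le_trans (ler_normD _ _) _; apply: le_trans (lerD (ler_normD _ _) (lexx _)) _.
rewrite !normrM.
have h1 : `|P.[t] - f t| * `|Q.[t] - g t| <= d * A.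
  by rewrite ler_pM ?hP //; apply: le_trans (hQ t ht) _; lra.
have h2 : `|P.[t] - f t| * `|g t| <= d * A by rewrite ler_pM ?hP.
have h3 : `|f t| * `|Q.[t] - g t| <= d * A by rewrite mulrC ler_pM ?hQ.
by lra.
Qed.

Lemma resolvent_uc C e : 0 <= C -> 0 < e -> uc C (fun t => (t + e)^-1).
Proof.
move=> C0 e0; have ie2 : 0 < (e ^+ 2)^-1 by rewrite invr_gt0 exprn_gt0.
apply: (lipschitz_uc C0 ie2) => s t s0 t0.
have se : 0 < s + e by rewrite ltr_wpDl.
have te : 0 < t + e by rewrite ltr_wpDl.
have -> : (s + e)^-1 - (t + e)^-1 = ((s + e) * (t + e))^-1 * (t - s).
  by field; rewrite !gt_eqF.
rewrite normrM (distrC t) ler_wpM2r // ger0_norm ?invr_ge0 ?mulr_ge0 ?(ltW se) ?(ltW te) //.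
rewrite lef_pV2 ?posrE ?mulr_gt0 ?exprn_gt0 //.
by rewrite expr2 ler_pM ?(ltW e0) // lerDr.
Qed.

End Weierstrass.

(** * Tents and cutoffs on the half-line *)

Section Tents.
Context {R : realType}.
Implicit Types (s t e C q : R) (i n : nat).

Definition ramp (s : R) : R := Num.min (Num.max s 0) 1.

Lemma ramp_ge0 s : 0 <= ramp s.
Proof. by rewrite le_min ler01 le_max lexx orbT. Qed.
Lemma ramp_le1 s : ramp s <= 1.
Proof. by rewrite ge_min lexx orbT. Qed.
Lemma ramp_eq0 s : s <= 0 -> ramp s = 0.
Proof. by move=> s0; rewrite /ramp (max_idPr s0) (min_idPl ler01). Qed.
Lemma ramp_le s t : s <= t -> ramp s <= ramp t.
Proof. by move=> st; rewrite /ramp; apply: le_min2 => //; apply: le_max2. Qed.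

Lemma rampP s : [\/ ramp s = 0 /\ s <= 0, ramp s = s /\ 0 <= s <= 1 | ramp s = 1 /\ 1 <= s].
Proof.
rewrite /ramp; case: (leP s 0) => s0; first by constructor 1; rewrite (min_idPl ler01).
by case: (leP s 1) => s1; [constructor 2; rewrite (ltW s0)|constructor 3; rewrite ltW].
Qed.

Lemma ramp_lipschitz s t : `|ramp s - ramp t| <= `|s - t|.
Proof.
wlog st : s t / s <= t.
  by move=> W; have [/W//|/ltW/W] := leP s t; rewrite distrC (distrC s).
rewrite distrC (distrC s) ger0_norm ?subr_ge0 ?ramp_le // ger0_norm ?subr_ge0 //.
by case: (rampP s) => -[-> ?]; case: (rampP t) => -[-> ?]; lra.
Qed.

(* The tent centred at [(i + 1) e] with half-width [e]. *)
Definition tent e i t := ramp (t / e - i%:R) - ramp (t / e - i.+1%:R).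

Lemma tent_ge0 e i t : 0 <= tent e i t.
Proof. by rewrite subr_ge0 ramp_le // lerD2l lerN2 ler_nat. Qed.

Lemma tent_eq0 e i t : 0 < e -> t <= i%:R * e -> tent e i t = 0.
Proof.
move=> e0 h; have h1 : t / e <= i%:R by rewrite ler_pdivrMr.
rewrite /tent !ramp_eq0 ?subrr // ?subr_le0 //.
by apply: le_trans h1 _; rewrite ler_nat.
Qed.

Lemma tent_uc C e i : 0 <= C -> 0 < e -> uc C (tent e i).
Proof.
move=> C0 e0; have K0 : 0 < 2 / e by rewrite divr_gt0.
apply: (lipschitz_uc C0 K0) => s t _ _.
have h j : `|ramp (s / e - j) - ramp (t / e - j)| <= `|s - t| / e.
  apply: le_trans (ramp_lipschitz _ _) _.
  by rewrite opprB addrA subrK -mulrBl normrM (ger0_norm (_ : 0 <= e^-1)) ?invr_ge0 // ltW.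
have h1 := h i%:R; have h2 := h i.+1%:R.
have -> : tent e i s - tent e i t = (ramp (s / e - i%:R) - ramp (t / e - i%:R)) -
  (ramp (s / e - i.+1%:R) - ramp (t / e - i.+1%:R)) by rewrite /tent; ring.
apply: le_trans (ler_normB _ _) _.
by rewrite mulrAC; lra.
Qed.

Lemma tent_sum e n t : \sum_(i < n) tent e i t = ramp (t / e) - ramp (t / e - n%:R).
Proof.
elim: n => [|n IH]; first by rewrite big_ord0 subr0 subrr.
by rewrite big_ord_recr /= IH /tent subrKA.
Qed.

Lemma tent_sum_le1 e n t : \sum_(i < n) tent e i t <= 1.
Proof. by rewrite tent_sum; have := ramp_ge0 (t / e - n%:R); have := ramp_le1 (t / e); lra. Qed.

(** With [s = t / e], Abel summation leaves a sum of ramps, which is [s - 1] clipped to [[0, n]].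
    The weight [i e] is the left end of the support of tent [i] and not its centre, hence the shift
    by [e]. *)
Lemma tent_moment e n t : 0 < e -> t <= n%:R * e ->
  \sum_(i < n) i%:R * e * tent e i t = Num.max (t - e) 0.
Proof.
move=> e0 ht.
have abel m : \sum_(i < m) i%:R * tent e i t =
    \sum_(i < m) ramp (t / e - i.+1%:R) - m%:R * ramp (t / e - m%:R).
  elim: m => [|m IH]; first by rewrite !big_ord0 mul0r subr0.
  by rewrite !big_ord_recr /= IH /tent -!natr1; ring.
have clip s m : \sum_(i < m) ramp (s - i.+1%:R) = Num.min (Num.max (s - 1) 0) m%:R.
  elim: m => [|m IH]; first by rewrite big_ord0 minC min_l // le_max lexx orbT.
  rewrite big_ord_recr /= IH -!natr1.
  have := ler0n R m; move: (m%:R) => x x0.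
  case: (leP (s - 1) 0) => ?; case: (leP _ x) => ?; case: (leP _ (x + 1)) => ?;
  by case: (rampP (s - (x + 1))) => -[-> ?]; lra.
have se : t / e <= n%:R by rewrite ler_pdivrMr.
under eq_bigr do rewrite mulrAC.
rewrite -mulr_suml abel clip (ramp_eq0 (_ : _ - _ <= 0)) ?subr_le0 // mulr0 subr0.
rewrite min_l; last by rewrite ge_max ler0n andbT; lra.
rewrite maxr_pMl ?ltW // mul0r mulrBl mul1r divfK ?gt_eqF //.
Qed.

(** Tent [i] is nonzero only where [i e < t], so its weight is at most [t ^ q] there. *)
Lemma tent_powR_sum e n q t : 0 < e -> 0 < q -> 0 <= t ->
  \sum_(i < n) (i%:R * e) `^ q * tent e i t <= t `^ q.
Proof.
move=> e0 q0 t0; apply: le_trans (_ : \sum_(i < n) t `^ q * tent e i t <= _).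
  apply: ler_sum => i _; have [ht|ht] := leP t (i%:R * e).
    by rewrite tent_eq0 // !mulr0.
  rewrite ler_wpM2r ?tent_ge0 // ge0_ler_powR ?nnegrE ?(ltW q0) ?mulr_ge0 ?(ltW e0) //.
  exact: ltW.
by rewrite -mulr_sumr -[X in _ <= X]mulr1 ler_wpM2l ?powR_ge0 // tent_sum_le1.
Qed.

Definition cutoff e t := Num.max (t - e) 0.

Lemma cutoff_uc C e : 0 <= C -> uc C (cutoff e).
Proof.
move=> C0; apply: (lipschitz_uc C0 ltr01) => s t _ _; rewrite mul1r /cutoff.
have -> : s - t = (s - e) - (t - e) by ring.
move: (s - e) (t - e) => {}s {}t.
wlog st : s t / s <= t.
  by move=> W; have [/W//|/ltW/W] := leP s t; rewrite distrC (distrC s).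
rewrite distrC (distrC s) (ger0_norm (_ : 0 <= t - s)) ?subr_ge0 //.
rewrite ger0_norm ?subr_ge0 ?le_max2 //.
by case: (leP s 0) => ?; case: (leP t 0) => ?; lra.
Qed.

Lemma cutoff_ge0 e t : 0 <= cutoff e t.
Proof. by rewrite le_max lexx orbT. Qed.

Lemma cutoff_eq0 e t : t <= e -> cutoff e t = 0.
Proof. by move=> te; rewrite /cutoff max_r // subr_le0. Qed.

Lemma cutoff_le e t : 0 <= e -> 0 <= t -> cutoff e t <= t.
Proof. by move=> e0 t0; rewrite ge_max t0 andbT gerBl. Qed.

Lemma cutoff_anti e e' t : e <= e' -> cutoff e' t <= cutoff e t.
Proof. by move=> ee; rewrite /cutoff; apply: le_max2 => //; rewrite lerD2l lerN2. Qed.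

Lemma cutoff_sqr C e t : 0 < e -> 0 <= t <= C -> t ^+ 2 <= cutoff e t ^+ 2 + 2 * C * e.
Proof.
move=> e0 /andP[t0 tC]; have [te|et] := leP t e.
  by rewrite cutoff_eq0 // expr0n /= add0r; nra.
by rewrite /cutoff max_l ?subr_ge0 ?(ltW et) //; nra.
Qed.

End Tents.

(** * Continuous calculus *)

Section ContinuousCalculus.
Context {R : realType} {H : hilbertType R}.
Implicit Types (u v w : H) (a b c : bop H) (f g : R -> R) (C : R).

(* [fcr a C f b]: [b] is the value at [a] of the continuous function [f] on
   [`[0, C]], an interval that contains the spectrum of [a]. *)
Definition fcr a C f b := forall e, 0 < e -> exists P : {poly R},
  (forall t, 0 <= t <= C -> `|P.[t] - f t| <= e) /\ opb e (peval a P - b).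

(** By [spec_bounds] this confines the spectrum of [a] to [[0, C]]. *)
Definition pbd C a := [/\ 0 < C, pos a & opb C a].

Lemma pbd_exists a : pos a -> exists C, pbd C a.
Proof. by move=> pa; have [C C0 hC] := bop_opb a; exists C. Qed.

Lemma pbdW C C' a : C <= C' -> pbd C a -> pbd C' a.
Proof. by move=> CC [C0 pa ha]; split=> //; [exact: lt_le_trans CC|exact: opbW ha]. Qed.

Lemma pbd_opb a C P e : pbd C a -> 0 <= e ->
  (forall t, 0 <= t <= C -> `|P.[t]| <= e) -> opb e (peval a P).
Proof.
move=> [C0 pa ha] e0 hP; apply: peval_opb => //; first exact: pos_sa.
by move=> t /(spec_bounds (ltW C0) pa ha); exact: hP.
Qed.

Lemma fcr_exists a C f : pbd C a -> papprox C f -> exists b, fcr a C f b.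
Proof.
move=> ha hf.
have i0 n : 0 < n.+1%:R^-1 :> R by rewrite invr_gt0.
have /choice [P hP] n := hf _ (i0 n).
have dP e m n : 0 < e -> m.+1%:R^-1 <= e -> n.+1%:R^-1 <= e ->
    opb (2 * e) (peval a (P m) - peval a (P n)).
  move=> e0 hm hn; rewrite -pevalB; apply: (pbd_opb ha); first by rewrite mulr_ge0 ?ltW.
  move=> t ht; rewrite hornerD hornerN.
  have -> : (P m).[t] - (P n).[t] = ((P m).[t] - f t) - ((P n).[t] - f t) by ring.
  apply: le_trans (ler_normB _ _) _; rewrite mulrDl mul1r.
  by apply: lerD; [apply: le_trans hm; exact: hP|apply: le_trans hn; exact: hP].
have [|b hb] := @bop_complete _ _ (fun n => peval a (P n)).
  move=> e e0; have e2 : 0 < e / 2 by rewrite divr_gt0.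
  have [N HN] := archi_inv e2; exists N => m n mN nN.
  have -> : e = 2 * (e / 2) by field.
  by apply: dP => //; exact: HN.
exists b => e e0; have [N HN] := archi_inv e0; have [M HM] := hb e e0.
exists (P (maxn N M)); split; last exact/HM/leq_maxr.
move=> t ht; apply: le_trans (hP _ _ ht) _; exact/HN/leq_maxl.
Qed.

Lemma fcr_fun a C f b : pbd C a -> fcr a C f b -> fun_calculus f a = b.
Proof.
move=> [C0 pa ha] hb; apply: fun_calculusE; first exact: pos_sa.
split=> [|e e0]; first exact: bopP.
have [P [h1 h2]] := hb e e0; exists P; split.
  by move=> t /spectrumE /(spec_bounds (ltW C0) pa ha); exact: h1.
by move=> u; rewrite poly_opE -bopBE !normE -(rmorphM (real_complex R)) lecR.
Qed.

Lemma fcr_ext a C f g b : (forall t, 0 <= t <= C -> f t = g t) -> fcr a C f b -> fcr a C g b.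
Proof.
move=> fg hb e e0; have [P [h1 h2]] := hb e e0; exists P; split=> // t ht.
by rewrite -fg // h1.
Qed.

Lemma fcr_poly a C (P : {poly R}) : fcr a C (fun t => P.[t]) (peval a P).
Proof.
move=> e e0; exists P; split=> [t _|u]; first by rewrite subrr normr0 ltW.
by rewrite subrr bopE nm0 mulr_ge0 ?nm_ge0 // ltW.
Qed.

Lemma fcrD a C f g b c : fcr a C f b -> fcr a C g c -> fcr a C (fun t => f t + g t) (b + c).
Proof.
move=> hf hg e e0; have e2 : 0 < e / 2 by rewrite divr_gt0.
have [P [P1 P2]] := hf _ e2; have [Q [Q1 Q2]] := hg _ e2; exists (P + Q).
have ee : e = e / 2 + e / 2 by field.
split=> [t ht|].
  by rewrite hornerD opprD addrACA ee; apply: le_trans (ler_normD _ _) _; rewrite lerD ?P1 ?Q1.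
by rewrite pevalD opprD addrACA ee; exact: opbD.
Qed.

Lemma fcrZ a C f b r : fcr a C f b -> fcr a C (fun t => r * f t) (r *: b).
Proof.
move=> hf e e0; have r1 : 0 < `|r| + 1 by rewrite ltr_wpDl.
have [P [P1 P2]] := hf _ (divr_gt0 e0 r1); exists (r *: P).
have h : `|r| * (e / (`|r| + 1)) <= e.
  by rewrite mulrCA -[X in _ <= X]mulr1 ler_wpM2l ?(ltW e0) // ler_pdivrMr // mul1r lerDl.
split=> [t ht|].
  by rewrite hornerZ -mulrBr normrM; apply: le_trans h; rewrite ler_wpM2l // P1.
by rewrite pevalZ -scalerBr; apply: opbW h _; exact: opbZ.
Qed.

Lemma fcrC a C r : fcr a C (fun _ => r) r%:B.
Proof.
rewrite -(pevalC a); apply: fcr_ext (@fcr_poly a C r%:P) => t _.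
by rewrite hornerC.
Qed.

Lemma fcr_id a C : fcr a C id a.
Proof.
rewrite -{2}(pevalX a); apply: fcr_ext (@fcr_poly a C 'X) => t _.
by rewrite hornerX.
Qed.

Lemma fcrB a C f g b c : fcr a C f b -> fcr a C g c -> fcr a C (fun t => f t - g t) (b - c).
Proof.
move=> hf hg; rewrite -(scaleN1r c).
by apply: fcr_ext (fcrD hf (fcrZ (-1) hg)) => t _; rewrite mulN1r.
Qed.

Lemma fcr_sum a C (I : Type) (s : seq I) (f : I -> R -> R) (b : I -> bop H) :
  (forall i, fcr a C (f i) (b i)) ->
  fcr a C (fun t => \sum_(i <- s) f i t) (\sum_(i <- s) b i).
Proof.
move=> h; elim: s => [|i s IH].
  rewrite big_nil -(scale0r (1 : bop H)); apply: fcr_ext (fcrC a C 0) => t _.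
  by rewrite big_nil.
rewrite big_cons; apply: fcr_ext (fcrD (h i) IH) => t _.
by rewrite big_cons.
Qed.

Lemma opb_lim b K : (forall e, 0 < e -> opb (K + e) b) -> opb K b.
Proof.
move=> h u; rewrite -subr_le0; apply: le0_of_eps => e e0.
have h1 : 0 < nm u + 1 by rewrite ltr_pwDr ?nm_ge0.
have := h _ (divr_gt0 e0 h1) u; rewrite mulrDl.
have : e / (nm u + 1) * nm u <= e.
  by rewrite mulrAC ler_pdivrMr // ler_wpM2l ?ltW // ltrDl.
by lra.
Qed.

Lemma fcr_opb a C f b K : pbd C a -> fcr a C f b -> 0 <= K ->
  (forall t, 0 <= t <= C -> `|f t| <= K) -> opb K b.
Proof.
move=> ha hb K0 hf; apply: opb_lim => e e0.
have e2 : 0 < e / 2 by rewrite divr_gt0.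
have [P [P1 P2]] := hb _ e2.
have -> : b = peval a P - (peval a P - b) by rewrite opprB addrC subrK.
have -> : K + e = (K + e / 2) + e / 2 by field.
apply: opbD; last exact: opbN.
apply: (pbd_opb ha) => [|t ht]; first by rewrite addr_ge0 // ltW.
by have := ler_normD (P.[t] - f t) (f t); rewrite subrK; have := P1 t ht; have := hf t ht; lra.
Qed.

Lemma fcr_uniq a C f b c : pbd C a -> fcr a C f b -> fcr a C f c -> b = c.
Proof.
move=> ha hb hc; apply/eqP; rewrite -subr_eq0; apply/eqP/opb_eq0 => e e0.
apply: (fcr_opb ha (fcrB hb hc)) => [|t _]; first exact: ltW.
by rewrite subrr normr0 ltW.
Qed.

Lemma fcr_sa a C f b : pbd C a -> fcr a C f b -> selfadj b.
Proof.
move=> [C0 pa ha] hb; apply/eqP; rewrite -subr_eq0; apply/eqP/opb_eq0 => e e0.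
have e2 : 0 < e / 2 by rewrite divr_gt0.
have [P [P1 P2]] := hb _ e2.
have -> : e = e / 2 + e / 2 by field.
have -> : star b - b = (peval a P - b) - star (peval a P - b).
  rewrite starB (peval_sa P (pos_sa pa)) opprB [RHS]addrC.
  by rewrite subrKA.
by apply: opbD => //; apply: opbN; apply: opb_star => //; exact: ltW.
Qed.

Lemma fcr_pos a C f b : pbd C a -> fcr a C f b -> (forall t, 0 <= t <= C -> 0 <= f t) -> pos b.
Proof.
move=> ha hb hf; split; first exact: fcr_sa hb.
move=> u; rewrite -oppr_le0; apply: le0_of_eps => e e0.
have h1 : 0 < nm u ^+ 2 + 1 by rewrite ltr_pwDr ?sqr_ge0.
pose d := e / (nm u ^+ 2 + 1).
have d2 : 0 < d / 2 by rewrite !divr_gt0.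
have [P [P1 P2]] := hb _ d2.
have pP : pos (peval a (P + (d / 2)%:P)).
  case: (ha) => C0 pa oa; apply: peval_pos; first exact: pos_sa.
  move=> t /(spec_bounds (ltW C0) pa oa) ht; rewrite hornerD hornerC.
  by have := P1 t ht; have := hf t ht; rewrite ler_norml => ? /andP[? ?]; lra.
have := pos_ip u pP; rewrite pevalD pevalC !bopE ipDl ipZl ipuu.
have := opb_ip u u P2; rewrite -expr2 !bopE ipBl ler_norml => /andP[_].
have : d * nm u ^+ 2 <= e.
  by rewrite /d mulrAC ler_pdivrMr // ler_wpM2l ?ltW // ltrDl.
by lra.
Qed.

Lemma fcr_le a C f g b c : pbd C a -> fcr a C f b -> fcr a C g c ->
  (forall t, 0 <= t <= C -> f t <= g t) -> ple b c.
Proof.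
move=> ha hb hc fg; apply: (fcr_pos ha (fcrB hc hb)) => t ht.
by rewrite subr_ge0 fg.
Qed.

Lemma fcr_comm a C f b c : c * a = a * c -> fcr a C f b -> c * b = b * c.
Proof.
move=> h hb; apply/eqP; rewrite -subr_eq0; apply/eqP/opb_eq0 => e e0.
have [K K0 hK] := bop_opb c.
have e2 : 0 < e / 2 / K by rewrite !divr_gt0.
have [P [P1 P2]] := hb _ e2.
have -> : e = K * (e / 2 / K) + (e / 2 / K) * K by field; rewrite gt_eqF.
have -> : c * b - b * c = - (c * (peval a P - b)) + (peval a P - b) * c.
  by rewrite mulrBr mulrBl opprB (peval_comm P h) addrA subrK.
by apply: opbD; [apply: opbN; apply: opbM => //|apply: opbM => //]; exact: ltW.
Qed.

Lemma papprox_fcr a C f b : fcr a C f b -> papprox C f.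
Proof. by move=> hb e /hb [P [hP _]]; exists P. Qed.

Lemma papprox_bounded C f : papprox C f -> exists2 K, 0 < K & forall t, 0 <= t <= C -> `|f t| <= K.
Proof.
move=> /(_ 1 ltr01) [P hP].
have [K hK] : exists K, forall t, 0 <= t <= C -> `|P.[t]| <= K.
  elim/poly_ind: P {hP} => [|P c [K hK]]; first by exists 0 => t _; rewrite horner0 normr0.
  exists (K * C + `|c|) => t ht; rewrite hornerMXaddC.
  apply: le_trans (ler_normD _ _) _; rewrite lerD2r normrM.
  case/andP: (ht) => t0 tC.
  by rewrite ler_pM // ?hK // ger0_norm.
exists (`|K| + 1) => [|t ht]; first by rewrite ltr_wpDl.
have := ler_normB P.[t] (P.[t] - f t); rewrite opprB addrC subrK.
by have := hP t ht; have := hK t ht; have := ler_norm K; lra.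
Qed.

Lemma fcrM a C f g b c : pbd C a -> fcr a C f b -> fcr a C g c ->
  fcr a C (fun t => f t * g t) (b * c).
Proof.
move=> ha hb hc.
have [K K0 hK] := papprox_bounded (papprox_fcr hb).
have [L L0 hL] := papprox_bounded (papprox_fcr hc).
have [d hd] := fcr_exists ha (papproxM (papprox_fcr hb) (papprox_fcr hc) hK hL).
suff -> : b * c = d by [].
apply/eqP; rewrite -subr_eq0; apply/eqP/opb_eq0 => e e0.
pose A := K + L + 1; have A0 : 0 < A by rewrite /A; lra.
pose s := Num.min 1 (e / (4 * A)).
have s0 : 0 < s by rewrite lt_min ltr01 divr_gt0 // mulr_gt0.
have sA : s * A <= e / 4.
  by rewrite -ler_pdivlMr // -mulrA -invfM ge_min lexx orbT.
have s1 : s <= 1 by rewrite ge_min lexx.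
have [P [P1 P2]] := hb _ s0; have [Q [Q1 Q2]] := hc _ s0.
have bK := fcr_opb ha hb (ltW K0) hK.
have e0' : 0 < e / 4 by rewrite divr_gt0.
have aux (x y x' y' : R) : `|x - x'| <= s -> `|y - y'| <= s -> `|x'| <= K -> `|y'| <= L ->
    `|x * y - x' * y'| <= e / 2.
  move=> h1 h2 h3 h4.
  have -> : x * y - x' * y' = (x - x') * (y - y') + (x - x') * y' + x' * (y - y') by ring.
  apply: le_trans (ler_normD _ _) _; apply: le_trans (lerD (ler_normD _ _) (lexx _)) _.
  rewrite !normrM.
  have i1 : `|x - x'| * `|y - y'| <= s * 1 by rewrite ler_pM // (le_trans h2).
  have i2 : `|x - x'| * `|y'| <= s * L by rewrite ler_pM.
  have i3 : `|x'| * `|y - y'| <= K * s by rewrite ler_pM.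
  have : s * A = s * 1 + s * L + K * s by rewrite /A; ring.
  by lra.
have h1 : opb (e / 2) (peval a (P * Q) - d).
  apply: (fcr_opb ha (fcrB (@fcr_poly a C (P * Q)) hd)); first by rewrite divr_ge0 ?ltW.
  by move=> t ht; rewrite hornerM; apply: aux; rewrite ?P1 ?Q1 ?hK ?hL.
have -> : b * c - d = (b * c - peval a (P * Q)) + (peval a (P * Q) - d) by rewrite subrKA.
have -> : e = e / 2 + e / 2 by field.
apply: opbD => //.
have cL := fcr_opb ha hc (ltW L0) hL.
have -> : b * c - peval a (P * Q) =
    - ((peval a P - b) * (peval a Q - c) + (peval a P - b) * c + b * (peval a Q - c)).
  rewrite -mulrDr subrK mulrBl mulrBr pevalM addrA subrK.
  by rewrite opprB.
apply: opbN; apply: opbW (_ : s * s + s * L + K * s <= _) _.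
  have : s * A = s * 1 + s * L + K * s by rewrite /A; ring.
  have : s * s <= s * 1 by rewrite ler_pM2l.
  by lra.
by apply: opbD; [apply: opbD|]; apply: opbM => //; exact: ltW.
Qed.

Lemma fcr_comp a C f b C' g c : pbd C a -> fcr a C f b -> pbd C' b ->
  (forall t, 0 <= t <= C -> 0 <= f t <= C') -> fcr b C' g c ->
  fcr a C (fun t => g (f t)) c.
Proof.
move=> ha hb hb' fC hc e e0; have e2 : 0 < e / 2 by rewrite divr_gt0.
have [Q [Q1 Q2]] := hc _ e2.
have hQ : fcr a C (fun t => Q.[f t]) (peval b Q).
  elim/poly_ind: (Q) => [|P r IH].
    rewrite peval0 -(scale0r (1 : bop H)).
    by apply: fcr_ext (@fcrC a C 0) => t _; rewrite horner0.
  rewrite pevalD pevalMX pevalC.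
  apply: fcr_ext (fcrD (fcrM ha IH hb) (fcrC a C r)) => t _.
  by rewrite hornerMXaddC.
have [P [P1 P2]] := hQ _ e2; exists P.
have ee : e = e / 2 + e / 2 by field.
split=> [t ht|].
  have -> : P.[t] - g (f t) = (P.[t] - Q.[f t]) + (Q.[f t] - g (f t)) by ring.
  by rewrite ee; apply: le_trans (ler_normD _ _) _; rewrite lerD ?P1 ?Q1 ?fC.
have -> : peval a P - c = (peval a P - peval b Q) + (peval b Q - c) by rewrite subrKA.
by rewrite ee; exact: opbD.
Qed.

(** True for polynomials by induction, then in the limit. One polynomial has to serve both [a] and
    [a'], whose spectra may differ; [fcr] allows this by asking for approximation on all of
    [[0, C]]. With [a = star z * z] and [a' = z * star z] it takes the place of a polar
    decomposition of [z]. *)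
Lemma fcr_intertwine a a' C f b b' z : pbd C a -> pbd C a' -> z * a = a' * z ->
  fcr a C f b -> fcr a' C f b' -> z * b = b' * z.
Proof.
move=> ha ha' h hb hb'; apply/eqP; rewrite -subr_eq0; apply/eqP/opb_eq0 => e e0.
have [K K0 hK] := bop_opb z.
have e2 : 0 < e / 2 / K by rewrite !divr_gt0.
have [P [P1 P2]] := hb _ e2.
have P3 : opb (e / 2 / K) (peval a' P - b').
  by apply: (fcr_opb ha' (fcrB (@fcr_poly a' C P) hb')) => //; exact: ltW.
have hP : z * peval a P = peval a' P * z.
  elim/poly_ind: (P) => [|Q r IH].
    by rewrite !peval0 mulr0 mul0r.
  rewrite !pevalD !pevalMX !pevalC mulrDl mulrDr mulrA IH -!mulrA h.
  by rewrite bscalerAr bscalerAl mulr1 mul1r.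
have -> : e = K * (e / 2 / K) + (e / 2 / K) * K by field; rewrite gt_eqF.
have -> : z * b - b' * z = - (z * (peval a P - b)) + (peval a' P - b') * z.
  by rewrite mulrBr mulrBl opprB hP addrA subrK.
by apply: opbD; [apply: opbN; apply: opbM => //|apply: opbM => //]; exact: ltW.
Qed.

End ContinuousCalculus.

(** * Powers and absolute values *)

Section Powers.
Context {R : realType} {H : hilbertType R}.
Implicit Types (u v w : H) (a b c z : bop H) (f g : R -> R) (C r s : R).

(** Quantifying over every admissible [C] makes the power independent of the bound; [powb_fcr] shows
    that such an operator exists when [0 < r]. *)
Definition powb a r : bop H :=
  xget 0 [set b | forall C, pbd C a -> fcr a C (fun t => t `^ r) b].

Lemma powb_fcr a r C : 0 < r -> pbd C a -> fcr a C (fun t => t `^ r) (powb a r).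
Proof.
move=> r0 ha; have C0 : 0 < C by case: ha.
rewrite /powb; case: xgetP => [b _ hb|]; first exact: hb.
have [b hb] := fcr_exists ha (weierstrass C0 (powR_uc C0 r0)).
move=> /(_ b); case=> C' ha'; have C0' : 0 < C' by case: ha'.
have [b' hb'] := fcr_exists ha' (weierstrass C0' (powR_uc C0' r0)).
(* Both values are [fun_calculus] at [a], which does not mention the bound. *)
suff -> : b = b' by [].
by apply: bop_eq; rewrite -(fcr_fun ha hb) -(fcr_fun ha' hb').
Qed.

Lemma power_opE a r : 0 < r -> pos a -> power_op a r = powb a r.
Proof. by move=> r0 /pbd_exists [C ha]; exact: fcr_fun (powb_fcr r0 ha). Qed.

Lemma powb_pos a r : 0 < r -> pos a -> pos (powb a r).
Proof.
move=> r0 /pbd_exists [C ha]; apply: (fcr_pos ha (powb_fcr r0 ha)) => t _.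
exact: powR_ge0.
Qed.

Lemma powb_comm a c r : 0 < r -> pos a -> c * a = a * c -> c * powb a r = powb a r * c.
Proof. by move=> r0 /pbd_exists [C ha] h; exact: fcr_comm h (powb_fcr r0 ha). Qed.

Lemma powb1 a : pos a -> powb a 1 = a.
Proof.
move=> /pbd_exists [C ha]; apply: (fcr_uniq ha (powb_fcr ltr01 ha)).
by apply: fcr_ext (@fcr_id _ _ a C) => t /andP[t0 _]; rewrite powRr1.
Qed.

Lemma powbD a r s : 0 < r -> 0 < s -> pos a -> powb a r * powb a s = powb a (r + s).
Proof.
move=> r0 s0 /pbd_exists [C ha]; have rs : 0 < r + s by exact: addr_gt0.
apply: (fcr_uniq ha _ (powb_fcr rs ha)).
apply: fcr_ext (fcrM ha (powb_fcr r0 ha) (powb_fcr s0 ha)) => t _.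
by rewrite powRD // gt_eqF ?implybT // addr_gt0.
Qed.

Lemma powb_half a r : 0 < r -> pos a -> powb a (r / 2) * powb a (r / 2) = powb a r.
Proof.
move=> r0 pa; have r2 : 0 < r / 2 by rewrite divr_gt0.
by rewrite powbD //; congr powb; field.
Qed.

Lemma powb_sqrt a : pos a -> powb a 2^-1 * powb a 2^-1 = a.
Proof. by move=> pa; rewrite -[2^-1]mul1r powb_half // powb1. Qed.

Lemma powbM a r s : 0 < r -> 0 < s -> pos a -> powb (powb a r) s = powb a (r * s).
Proof.
move=> r0 s0 pa; have [C ha] := pbd_exists pa; have rs : 0 < r * s by exact: mulr_gt0.
have [C' hb] := pbd_exists (powb_pos r0 pa).
have C0 : 0 < C by case: ha.
(* [fcr_comp] needs one bound for the norm of [powb a r] and for the range of [t ^ r] on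
   [[0, C]]. *)
pose D := Num.max C' (C `^ r).
have hD : pbd D (powb a r) by apply: pbdW hb; rewrite le_max lexx.
apply: (fcr_uniq ha _ (powb_fcr rs ha)).
apply: fcr_ext (fcr_comp ha (powb_fcr r0 ha) hD _ (powb_fcr s0 hD)).
  by move=> t _; rewrite powRrM.
move=> t /andP[t0 tC]; rewrite powR_ge0 le_max; apply/orP; right.
by rewrite ge0_ler_powR ?nnegrE // ltW.
Qed.

Definition absb z := powb (star z * z) 2^-1.

Lemma abs_opE z : abs_op z = absb z.
Proof.
rewrite /abs_op adjointE -power_opE ?invr_gt0 //; exact: pos_starM.
Qed.

Lemma absb_pos z : pos (absb z).
Proof. by apply: powb_pos; [rewrite invr_gt0|exact: pos_starM]. Qed.

Lemma absb_sqr z : absb z * absb z = star z * z.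
Proof. exact/powb_sqrt/pos_starM. Qed.

Lemma powb_abs z r : 0 < r -> powb (absb z) r = powb (star z * z) (r / 2).
Proof.
move=> r0; rewrite powbM ?invr_gt0 //; last exact: pos_starM.
by rewrite mulrC.
Qed.

Lemma absb_abs z : absb (absb z) = absb z.
Proof. by rewrite {1}/absb (pos_sa (absb_pos z)) absb_sqr. Qed.

(** The defect is [t ^ r * (d / (t + d))]. It is at most [e] for [t <= x = e ^ (1 / r)], where
    [t ^ r <= e]; beyond [x] it is at most [D * (d / x)], and [d] is chosen to make this equal to
    [e]. *)
Lemma powR_regularization C r e : 0 < C -> 0 < r -> 0 < e -> exists2 d, 0 < d &
  forall t, 0 <= t <= C -> t `^ r <= t * (t `^ r * (t + d)^-1) + e.
Proof.
move=> C0 r0 e0; pose x := e `^ r^-1; have x0 : 0 < x by rewrite powR_gt0.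
have xr : x `^ r = e by rewrite -powRrM mulVf ?gt_eqF // powRr1 // ltW.
pose D := C `^ r; have D0 : 0 < D by rewrite powR_gt0.
have d0 : 0 < e * x / D by rewrite divr_gt0 // mulr_gt0.
exists (e * x / D) => // t /andP[t0 tC]; set d := e * x / D.
have td : 0 < t + d by rewrite ltr_wpDl.
have q0 : 0 <= d / (t + d) by rewrite divr_ge0 // ltW.
rewrite [X in X <= _](_ : _ = t * (t `^ r * (t + d)^-1) + t `^ r * (d / (t + d))); last first.
  by field; rewrite gt_eqF.
rewrite lerD2l; have [tx|xt] := leP t x.
  have h1 : t `^ r <= e by rewrite -xr ge0_ler_powR ?nnegrE ?(ltW r0) // ltW.
  rewrite -[X in _ <= X]mulr1 ler_pM ?powR_ge0 // ler_pdivrMr // mul1r lerDr.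
  by [].
have h1 : t `^ r <= D by rewrite ge0_ler_powR ?nnegrE ?(ltW r0) // ltW.
have h2 : d / (t + d) <= d / x.
  by rewrite ler_pM2l // lef_pV2 ?posrE // (le_trans (ltW xt)) // lerDl ltW.
apply: le_trans (_ : D * (d / x) <= _); first by rewrite ler_pM ?powR_ge0.
by rewrite le_eqVlt; apply/orP; left; apply/eqP; rewrite /d; field; rewrite !gt_eqF.
Qed.

End Powers.
Arguments powb {R H} a%_ring_scope r%_ring_scope.
Arguments absb {R H} z%_ring_scope.

(** * The trace *)

Section Trace.
Context {R : realType} {H : hilbertType R} {M : set (H -> H)} {tr : (H -> H) -> \bar R}.
Hypotheses (hM : von_neumann_algebra M) (htr : is_trace M tr) (hnormal : normal_trace M tr).
Implicit Types (u : H) (a b c g w z : bop H) (f : R -> R) (C r : R).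

Definition inM a := M a.
Definition T a := tr a.
Arguments T a%_ring_scope.

Lemma inM1 : inM 1. Proof. exact: vna_id hM. Qed.
Lemma inMD a b : inM a -> inM b -> inM (a + b).
Proof. by move=> ha hb; have := vna_add hM ha hb. Qed.
Lemma inMM a b : inM a -> inM b -> inM (a * b).
Proof. by move=> ha hb; have := vna_comp hM ha hb. Qed.
Lemma inMZ r a : inM a -> inM (r *: a).
Proof. by move=> ha; have := vna_scale hM r%:C ha. Qed.
Lemma inMN a : inM a -> inM (- a).
Proof. by rewrite -scaleN1r; exact: inMZ. Qed.
Lemma inMB a b : inM a -> inM b -> inM (a - b).
Proof. by move=> ha hb; apply: inMD => //; exact: inMN. Qed.
Lemma inM_star a : inM a -> inM (star a).
Proof. by move=> ha; have := vna_adjoint hM ha; rewrite adjointE. Qed.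
Lemma inM0 : inM 0. Proof. by rewrite -(scale0r (1 : bop H)); exact: inMZ inM1. Qed.
Lemma inM_sum (I : Type) (s : seq I) (F : I -> bop H) :
  (forall i, inM (F i)) -> inM (\sum_(i <- s) F i).
Proof. by move=> h; elim/big_ind: _ => //; [exact: inM0|exact: inMD]. Qed.

(** [b] commutes with everything that commutes with [a], so it lies in the bicommutant of [M]. *)
Lemma fcr_inM a C f b : inM a -> fcr a C f b -> inM b.
Proof.
move=> ha hb; rewrite /inM -(vna_bicommutant hM); split; first exact: bopP.
move=> c [bc hc]; have := @fcr_comm _ _ a C f b (Bop bc) _ hb.
by move=> h; apply: (congr1 (@bfun R H) (h _)); apply: bop_eq; exact/esym/hc.
Qed.

Lemma powb_inM a r : 0 < r -> pos a -> inM a -> inM (powb a r).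
Proof. by move=> r0 /pbd_exists [C ha] h; exact: fcr_inM h (powb_fcr r0 ha). Qed.

Lemma absb_inM z : inM z -> inM (absb z).
Proof.
move=> hz; apply: powb_inM; [by rewrite invr_gt0|exact: pos_starM|].
by apply: inMM => //; exact: inM_star.
Qed.

Lemma pos_positive_op a : pos a -> positive_op a.
Proof.
move=> [sa pa] u; rewrite innerE lecE /= pa andbT.
have h : ip (('i)%C *: a u) u = - ip (('i)%C *: a u) u.
  rewrite -{1}bopZC starE sa [LHS]ipC ipZCr.
  have -> : (('i : R[i])^*)%C = - 'i%C by apply/eqP; rewrite eq_complex /= oppr0 !eqxx.
  by rewrite scaleNr ipNl.
by apply/eqP; lra.
Qed.

Lemma pos_cone a : inM a -> pos a -> positive_cone M a.
Proof. by move=> ha /pos_positive_op pa. Qed.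

Lemma op_leW a b : ple a b -> op_le a b.
Proof.
by move=> /pos_positive_op h u; have := h u; rewrite bopBE.
Qed.

Lemma T_ge0 a : inM a -> pos a -> (0 <= T a)%E.
Proof. by move=> ha pa; apply: (trace_ge0 htr); exact: pos_cone. Qed.

Lemma TD a b : inM a -> pos a -> inM b -> pos b -> T (a + b) = (T a + T b)%E.
Proof.
move=> ha pa hb pb; rewrite /T -(trace_add htr); [|exact: pos_cone|exact: pos_cone].
by [].
Qed.

Lemma TZ r a : 0 <= r -> inM a -> pos a -> T (r *: a) = (r%:E * T a)%E.
Proof. by move=> r0 ha pa; rewrite /T -(trace_scale htr r0) //; exact: pos_cone. Qed.

Lemma T_comm z : inM z -> T (star z * z) = T (z * star z).
Proof. by move=> hz; have := trace_comm htr hz; rewrite adjointE. Qed.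

Lemma T0 : T 0 = 0%E.
Proof. by rewrite -(scale0r (1 : bop H)) TZ ?mul0e //; [exact: inM1|exact: pos1]. Qed.

Lemma T_sum (I : Type) (s : seq I) (F : I -> bop H) :
  (forall i, inM (F i)) -> (forall i, pos (F i)) ->
  T (\sum_(i <- s) F i) = (\sum_(i <- s) T (F i))%E.
Proof.
move=> hF pF; elim: s => [|i s IH]; first by rewrite !big_nil T0.
rewrite !big_cons TD ?IH //; [exact: inM_sum|exact: pos_sum].
Qed.

Lemma T_le a b : inM a -> pos a -> inM b -> ple a b -> (T a <= T b)%E.
Proof.
move=> ha pa hb ab; rewrite -(subrKC a b) TD //; last exact: inMB.
by rewrite leeDl // T_ge0 //; exact: inMB.
Qed.

(* Normality turns a norm-convergent increasing family into a supremum. *)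
Lemma T_sup (F : R -> bop H) a (K : \bar R) : inM a -> pos a ->
  (forall d, 0 < d -> [/\ inM (F d), pos (F d) & ple (F d) a]) ->
  (forall d d', 0 < d -> d <= d' -> ple (F d') (F d)) ->
  (forall e, 0 < e -> exists2 d, 0 < d & ple a (F d + e%:B)) ->
  (forall d, 0 < d -> (T (F d) <= K)%E) -> (T a <= K)%E.
Proof.
move=> ha pa hF anti lim hK.
pose D := [set b : H -> H | exists2 d, 0 < d & b = F d].
rewrite /T (hnormal (D := D)).
- by apply: ge_ereal_sup => _ [_ [d d0 ->] <-]; exact: hK.
- by exists (F 1), 1.
- by move=> _ [d /hF [h1 h2 _] ->]; exact: pos_cone.
- move=> _ _ [d d0 ->] [d' d0' ->]; exists (F (Num.min d d')).
  have m0 : 0 < Num.min d d' by rewrite lt_min d0.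
  split; first by exists (Num.min d d').
    by apply: op_leW; apply: anti; rewrite // ge_min lexx.
  by apply: op_leW; apply: anti; rewrite // ge_min lexx orbT.
- exact: pos_cone.
- by move=> _ [d /hF [_ _ h] ->]; exact: op_leW.
(* It remains that [a] is below every upper bound [c]. Real parts compare by letting [e] tend to 0;
   imaginary parts vanish because [a] and [c] are positive. *)
move=> c [Mc pc] hc u.
have re : ip (a u) u <= ip (c u) u.
  rewrite -subr_le0; apply: le0_of_eps => e e0.
  have h1 : 0 < nm u ^+ 2 + 1 by rewrite ltr_pwDr ?sqr_ge0.
  have [d d0 /(ple_ip u)] := lim _ (divr_gt0 e0 h1).
  rewrite !bopE ipDl ipZl ipuu.
  have : op_le (F d) c by apply: hc; exists d.
  move=> /(_ u); rewrite lecE => /andP[_]; rewrite -/(ip _ _) ipBl /=.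
  have : e / (nm u ^+ 2 + 1) * nm u ^+ 2 <= e.
    by rewrite mulrAC ler_pdivrMr // ler_wpM2l ?ltW // ltrDl.
  by lra.
have := pc u; have := pos_positive_op pa u; rewrite !lecE /= => /andP[/eqP ia _] /andP[/eqP ic _].
rewrite linearBl /= raddfB raddfB /= ia ic subrr eqxx /=.
by rewrite -!/(ip _ _) subr_ge0.
Qed.

(** * Cyclicity of the trace for powers *)

(** As [d] decreases to 0, the [r]-th power of [star z * z] is the increasing limit of its values
    under [t * (t ^ r / (t + d))]. Splitting off the factor [t] and intertwining turns these into
    [star z * G * z] with [G] in the calculus of [z * star z], a form to which cyclicity applies. *)
Lemma T_powb_sup z r (K : \bar R) : inM z -> 0 < r ->
  (forall d C G, 0 < d -> pbd C (z * star z) ->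
     fcr (z * star z) C (fun t => t `^ r * (t + d)^-1) G -> (T (star z * G * z) <= K)%E) ->
  (T (powb (star z * z) r) <= K)%E.
Proof.
move=> hz r0 hK; set a := star z * z; set a' := z * star z.
have pa : pos a by exact: pos_starM.
have pa' : pos a' by exact: pos_Mstar.
have Ma : inM a by apply: inMM => //; exact: inM_star.
have [C1 h1] := pbd_exists pa; have [C2 h2] := pbd_exists pa'.
pose C := Num.max C1 C2.
have ha : pbd C a by apply: pbdW h1; rewrite le_max lexx.
have ha' : pbd C a' by apply: pbdW h2; rewrite le_max lexx orbT.
have C0 : 0 < C by case: ha.
have pf d : 0 < d -> papprox C (fun t : R => t `^ r * (t + d)^-1).
  move=> d0; have [[A hA] _] := powR_uc C0 r0.
  have u := resolvent_uc (ltW C0) d0; have [[B hB] _] := u.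
  by apply: papproxM hA hB; apply: weierstrass => //; exact: powR_uc.
(* The guard [0 < d] under the existential lets [choice] pick a [G] for every real [d]. *)
have exG c d : pbd C c -> exists G, 0 < d -> fcr c C (fun t => t `^ r * (t + d)^-1) G.
  move=> hc; have [d0|d0] := ltP 0 d; last by exists 0.
  by have [G hG] := fcr_exists hc (pf d d0); exists G.
have /choice [G hG] d := exG a d ha.
have hF d : 0 < d -> fcr a C (fun t => t * (t `^ r * (t + d)^-1)) (a * G d).
  by move=> d0; apply: fcrM => //; [exact: fcr_id|exact: hG].
have hP := powb_fcr r0 ha.
apply: (@T_sup (fun d => a * G d)).
- exact: powb_inM.
- exact: powb_pos.
- move=> d d0; split; first exact: fcr_inM (hF d d0).
    apply: (fcr_pos ha (hF d d0)) => t /andP[t0 _].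
    by rewrite !mulr_ge0 ?powR_ge0 // invr_ge0 addr_ge0 // ltW.
  apply: (fcr_le ha (hF d d0) hP) => t /andP[t0 _].
  have td : 0 < t + d by rewrite ltr_wpDl.
  rewrite mulrCA -[X in _ <= X]mulr1 ler_wpM2l ?powR_ge0 // ler_pdivrMr // mul1r lerDl.
  exact: ltW.
- move=> d d' d0 dd'; have d0' : 0 < d' by exact: lt_le_trans dd'.
  apply: (fcr_le ha (hF d' d0') (hF d d0)) => t /andP[t0 _].
  rewrite ler_wpM2l // ler_wpM2l ?powR_ge0 // lef_pV2 ?posrE ?ltr_wpDl //.
  by rewrite lerD2l.
- move=> e e0; have [d d0 hd] := powR_regularization C0 r0 e0.
  by exists d => //; apply: (fcr_le ha hP (fcrD (hF d d0) (fcrC a C e))).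
move=> d d0; have [G' hG'] := exG a' d ha'.
have -> : a * G d = star z * G' * z.
  rewrite /a -!mulrA; congr (_ * _).
  by apply: (fcr_intertwine ha ha' _ (hG d d0) (hG' d0)); rewrite /a /a' !mulrA.
exact: hK (hG' d0).
Qed.

(** With [s = sqrt G], which commutes with [z * star z], cyclicity for [s * z] moves
    [star z * G * z] to [z * star z * G]. This is below the [r]-th power because
    [t / (t + d) <= 1]. *)
Lemma T_powb_swap_le z r : inM z -> 0 < r ->
  (T (powb (star z * z) r) <= T (powb (z * star z) r))%E.
Proof.
move=> hz r0; apply: T_powb_sup => // d C G d0 ha hG.
have pa' : pos (z * star z) by exact: pos_Mstar.
have Ma' : inM (z * star z) by apply: inMM => //; exact: inM_star.
have MG : inM G by exact: fcr_inM hG.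
have pG : pos G.
  apply: (fcr_pos ha hG) => t /andP[t0 _].
  by rewrite mulr_ge0 ?powR_ge0 // invr_ge0 addr_ge0 // ltW.
have h2 : 0 < 2^-1 :> R by rewrite invr_gt0.
pose s := powb G 2^-1.
have ss : s * s = G by exact: powb_sqrt.
have ps : pos s by exact: powb_pos.
have Ms : inM s by exact: powb_inM.
have cs : z * star z * s = s * (z * star z).
  by apply: powb_comm => //; exact: fcr_comm hG.
have -> : star z * G * z = star (s * z) * (s * z).
  by rewrite starM (pos_sa ps) -!mulrA -ss !mulrA.
rewrite T_comm; last exact: inMM.
have -> : s * z * star (s * z) = z * star z * G.
  by rewrite starM (pos_sa ps) -ss [LHS]mulrA -(mulrA s) -cs !mulrA.
have hF := fcrM ha (@fcr_id _ _ (z * star z) C) hG.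
apply: T_le.
- exact: fcr_inM hF.
- apply: (fcr_pos ha hF) => t /andP[t0 _].
  by rewrite !mulr_ge0 ?powR_ge0 // invr_ge0 addr_ge0 // ltW.
- exact: powb_inM.
apply: (fcr_le ha hF (powb_fcr r0 ha)) => t /andP[t0 _].
have td : 0 < t + d by rewrite ltr_wpDl.
rewrite mulrCA -[X in _ <= X]mulr1 ler_wpM2l ?powR_ge0 // ler_pdivrMr // mul1r lerDl.
exact: ltW.
Qed.

Lemma T_powb_swap z r : inM z -> 0 < r ->
  T (powb (star z * z) r) = T (powb (z * star z) r).
Proof.
move=> hz r0; apply/eqP; rewrite eq_le T_powb_swap_le //=.
by have := T_powb_swap_le (inM_star hz) r0; rewrite starK.
Qed.

(** * Substitutes for Young and Cauchy-Schwarz on the positive cone *)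

Lemma T_conj_swap (h v : bop H) : selfadj h -> inM h -> inM v ->
  T (h * (star v * v) * h) = T (v * (h * h) * star v).
Proof.
move=> sh Mh Mv; have := T_comm (inMM Mv Mh).
by rewrite starM sh !mulrA.
Qed.
Lemma inM_conj a c : inM a -> inM c -> inM (star c * a * c).
Proof. by move=> ha hc; do 2![apply: inMM => //]; exact: inM_star. Qed.

Lemma inM_starM c : inM c -> inM (star c * c).
Proof. by move=> hc; apply: inMM => //; exact: inM_star. Qed.

(* Replacing [b] by the grid points [i e] through a partition of unity in [b]
   reduces the inequality to the scalar Young inequality in [a]. *)
Lemma T_young_shift a b w g C (e p q : R) :
  0 < p -> 0 < q -> p^-1 + q^-1 = 1 ->
  inM a -> pos a -> inM b -> pbd C b -> inM w -> ple (star w * w) 1 ->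
  inM g -> pos g -> 0 < e -> fcr b C (cutoff e) (g * g) ->
  (T (g * (star w * a * w) * g) <= p^-1%:E * T (powb a p) + q^-1%:E * T (powb b q))%E.
Proof.
move=> p0 q0 pq Ma pa Mb hb Mw cw Mg pg e0 hg.
have C0 : 0 < C by case: hb.
have pb : pos b by case: hb.
have h2 : 0 < 2^-1 :> R by rewrite invr_gt0.
have ip0 : 0 <= p^-1 by rewrite invr_ge0 ltW.
have iq0 : 0 <= q^-1 by rewrite invr_ge0 ltW.
have p20 : 0 < p / 2 by rewrite divr_gt0.
have [n hn] : exists n : nat, C <= n%:R * e.
  exists (Num.truncn (C / e)).+1; rewrite -ler_pdivrMr //.
  exact/ltW/truncnS_gt.
pose x (i : nat) := i%:R * e.
have x0 i : 0 <= x i by rewrite mulr_ge0 // ltW.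
have /choice [F hF] : forall i, exists B, fcr b C (tent e i) B.
  by move=> i; apply: fcr_exists => //; apply: weierstrass => //; exact: tent_uc (ltW C0) e0.
have pF i : pos (F i) by apply: (fcr_pos hb (hF i)) => t _; exact: tent_ge0.
have MF i : inM (F i) by exact: fcr_inM (hF i).
pose s i := powb (F i) 2^-1.
have ps i : pos (s i) by exact: powb_pos.
have Ms i : inM (s i) by exact: powb_inM.
have ss i : s i * s i = F i by exact: powb_sqrt.
pose ra := powb a 2^-1; pose rp := powb a (p / 2).
have pra : pos ra by exact: powb_pos.
have prp : pos rp by exact: powb_pos.
have Mra : inM ra by exact: powb_inM.
have Mrp : inM rp by exact: powb_inM.
have rr : ra * ra = a by exact: powb_sqrt.
have rrp : rp * rp = powb a p by exact: powb_half.
pose v := ra * w; pose y := rp * w.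
have Mv : inM v by exact: inMM.
have My : inM y by exact: inMM.
have vv : star v * v = star w * a * w by rewrite /v starM (pos_sa pra) -rr !mulrA.
have yy : star y * y = star w * powb a p * w by rewrite /y starM (pos_sa prp) -rrp !mulrA.
have Map : inM (powb a p) by exact: powb_inM.
have pap : pos (powb a p) by exact: powb_pos.
have Mbq : inM (powb b q) by exact: powb_inM.
have pbq : pos (powb b q) by exact: powb_pos.
have conjP (c d : bop H) : pos d -> pos (c * d * star c).
  by move=> pd; have := pos_conj (star c) pd; rewrite starK.
have conjM (c d : bop H) : inM c -> inM d -> inM (c * d * star c).
  by move=> Mc Md; have := inM_conj Md (inM_star Mc); rewrite starK.
have conjL (c d d' : bop H) : ple d d' -> ple (c * d * star c) (c * d' * star c).
  by move=> pd; have := ple_conj (star c) pd; rewrite starK.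
have Mxs : inM (\sum_(i < n) x i *: F i) by apply: inM_sum => i; exact: inMZ.
(* By [tent_moment] the grid sum is the cutoff itself and not an approximation, so it equals
   [g * g]. *)
have fxs : fcr b C (cutoff e) (\sum_(i < n) x i *: F i).
  apply: fcr_ext (fcr_sum _ (fun i : 'I_n => fcrZ (x i) (hF i))) => t /andP[t0 tC].
  by rewrite (tent_moment e0 (le_trans tC hn)).
(* Swap once to bring [g * g] between [v] and [star v], split it into the [x i *: F i], then swap
   each term back with [s i] in place of [g]. *)
have -> : T (g * (star w * a * w) * g) = (\sum_(i < n) (x i)%:E * T (s i * (star v * v) * s i))%E.
  rewrite -vv (T_conj_swap (pos_sa pg) Mg Mv).
  rewrite (fcr_uniq hb hg fxs) mulr_sumr mulr_suml T_sum.
  - apply: eq_bigr => i _; rewrite bscalerAr bscalerAl TZ //; [|exact: conjM|exact: conjP].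
    by rewrite T_conj_swap ?ss //; exact: pos_sa.
  - by move=> i; apply: conjM => //; exact: inMZ.
  - by move=> i; apply: conjP; exact: posZ.
have [Ca ha] := pbd_exists pa.
have young i : ple (x i *: a) (p^-1 *: powb a p + (q^-1 * x i `^ q)%:B).
  apply: (fcr_le ha (fcrZ (x i) (@fcr_id _ _ a Ca)) (fcrD (fcrZ p^-1 (powb_fcr p0 ha)) (fcrC a Ca _))).
  move=> t /andP[t0 _]; rewrite mulrC; apply: le_trans (conjugate_powR t0 (x0 i) p0 q0 pq) _.
  by rewrite ![_ / _]mulrC.
have step (i : 'I_n) : ((x i)%:E * T (s i * (star v * v) * s i) <=
   p^-1%:E * T (y * F i * star y) + q^-1%:E * T (x i `^ q *: F i))%E.
  have sai : selfadj (s i) by exact: pos_sa.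
  have sE c : s i * c * s i = star (s i) * c * s i by rewrite sai.
  have pc : pos (s i * (star v * v) * s i) by rewrite sE; apply: pos_conj; exact: pos_starM.
  have Mc : inM (s i * (star v * v) * s i) by do 2![apply: inMM => //]; exact: inM_starM.
  rewrite -TZ // (_ : T (y * F i * star y) = T (s i * (star y * y) * s i)); last first.
    by rewrite T_conj_swap ?ss.
  have pc' : pos (s i * (star y * y) * s i) by rewrite sE; apply: pos_conj; exact: pos_starM.
  have Mc' : inM (s i * (star y * y) * s i) by do 2![apply: inMM => //]; exact: inM_starM.
  have pxF : pos (x i `^ q *: F i) by apply: posZ => //; exact: powR_ge0.
  have MxF : inM (x i `^ q *: F i) by exact: inMZ.
  rewrite -TZ // -TZ // -TD; try (by exact: inMZ); try (by exact: posZ).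
  apply: T_le; [exact: inMZ|exact: posZ|by apply: inMD; exact: inMZ|].
  (* Conjugating Young's inequality by [w] and [s i] turns its constant term into a multiple of
     [s i * (star w * w) * s i], which is at most [F i] since [w] is a contraction. *)
  have := ple_conj (s i) (ple_conj w (young i)); rewrite sai.
  rewrite bscalerAr bscalerAl bscalerAr bscalerAl -vv.
  move=> /ple_trans; apply.
  rewrite mulrDr mulrDl mulrDr mulrDl !(bscalerAr, bscalerAl) -yy !mulr1 /ple opprD addrACA subrr add0r.
  rewrite -ss scalerA -scalerBr; apply: posZ; first by rewrite mulr_ge0 ?powR_ge0.
  have := ple_conj (s i) cw; rewrite sai mulr1; exact.
apply: (@le_trans _ _ (\sum_(i < n)
    (p^-1%:E * T (y * F i * star y) + q^-1%:E * T (x i `^ q *: F i)))%E).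
  by apply: lee_sum => i _; exact: step.
have TF i : (0 <= T (y * F i * star y))%E by apply: T_ge0; [exact: conjM|exact: conjP].
have TG i : (0 <= T (x i `^ q *: F i))%E.
  by apply: T_ge0; [exact: inMZ|apply: posZ => //; exact: powR_ge0].
rewrite big_split /= -!ge0_sume_distrr //.
apply: leeD; apply: lee_wpmul2l; rewrite ?lee_fin //.
  (* The [F i] add up to at most 1, which leaves [y * star y]; this is below [rp * rp] because
     [w * star w] is at most 1. *)
  rewrite -T_sum; [|by move=> i; exact: conjM|by move=> i; exact: conjP].
  rewrite -mulr_suml -mulr_sumr.
  have M1 : inM (\sum_(i < n) F i) by exact: inM_sum.
  have P1 : pos (\sum_(i < n) F i) by exact: pos_sum.
  have l1 : ple (\sum_(i < n) F i) 1.
    rewrite -(scale1r (1 : bop H)); apply: (fcr_le hb _ (fcrC b C 1)).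
      exact: fcr_sum (fun i : 'I_n => hF i).
    by move=> t _; exact: tent_sum_le1.
  apply: le_trans (T_le (conjM _ _ My M1) (conjP _ _ P1) (conjM _ _ My inM1) (conjL y _ _ l1)) _.
  rewrite mulr1.
  apply: T_le => //; [by apply: inMM => //; exact: inM_star|exact: pos_Mstar|].
  have := conjL rp _ _ (contr_star cw).
  by rewrite (pos_sa prp) mulr1 rrp /y starM (pos_sa prp) !mulrA.
rewrite -T_sum; [|by move=> i; exact: inMZ|by move=> i; apply: posZ => //; exact: powR_ge0].
have fq := fcr_sum (index_enum 'I_n) (fun i : 'I_n => fcrZ (x i `^ q) (hF i)).
apply: T_le => //; first exact: fcr_inM fq.
  by apply: pos_sum => i; apply: posZ => //; exact: powR_ge0.
apply: (fcr_le hb fq (powb_fcr q0 hb)) => t /andP[t0 _].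
exact: tent_powR_sum.
Qed.
(** Chebyshev's inequality: [f] vanishes up to [e] and is bounded by [K], so it is at most
    [K / e ^ q] times [t ^ q]. *)
Lemma T_cutoff_fin b C f g (e q : R) : 0 < q -> inM b -> pbd C b -> 0 < e ->
  fcr b C f g -> (forall t, 0 <= t <= C -> 0 <= f t) -> (forall t, t <= e -> f t = 0) ->
  (T (powb b q) < +oo)%E -> (T g < +oo)%E.
Proof.
move=> q0 Mb hb e0 hf f0 fe fin.
have pb : pos b by case: hb.
have [K K0 hK] := papprox_bounded (papprox_fcr hf).
have eq0 : 0 < e `^ q by rewrite powR_gt0.
have k0 : 0 <= K / e `^ q by rewrite divr_ge0 ?ltW.
have Mbq : inM (powb b q) by exact: powb_inM.
have pbq : pos (powb b q) by exact: powb_pos.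
apply: (@le_lt_trans _ _ ((K / e `^ q)%:E * T (powb b q))%E).
  rewrite -TZ //; apply: T_le; [exact: fcr_inM hf|exact: fcr_pos hf f0|exact: inMZ|].
  apply: (fcr_le hb hf (fcrZ (K / e `^ q) (powb_fcr q0 hb))) => t ht.
  have [te|et] := leP t e; first by rewrite fe // mulr_ge0 ?powR_ge0.
  have h1 : f t <= K by have := hK t ht; rewrite ger0_norm // f0.
  apply: le_trans h1 _; rewrite mulrAC -mulrA ler_peMr ?(ltW K0) // ler_pdivlMr // mul1r.
  by rewrite ge0_ler_powR ?nnegrE ?(ltW q0) ?(ltW e0) ?(ltW et) // (le_trans (ltW e0)) // ltW.
rewrite lte_mul_pinfty //; apply: T_ge0 => //.
Qed.

(* Stands for the Cauchy-Schwarz inequality for [T (star c * d)], an expression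
   that makes no sense since [tr] is only known on the positive cone. Here
   [star c * d = star m * n] with [m = x g^3] and [n = x g], and the proof is the identity
   [c^* c + d^* d + m^* m + n^* n = (c - d)^* (c - d) + (m + n)^* (m + n)]. *)
Lemma T_cauchy_schwarz (x c d g : bop H) : inM x -> inM c -> inM d -> inM g -> selfadj g ->
  star c * d = g * g * g * star x * x * g ->
  (T (g * (star x * x) * g) < +oo)%E -> (T (g * g * g * (star x * x) * (g * g * g)) < +oo)%E ->
  (2%:E * T (x * (g * g * g * g) * star x) <= T (star c * c) + T (star d * d))%E.
Proof.
move=> Mx Mc Md Mg sg cd fn fm.
pose m := x * (g * g * g); pose n := x * g.
have Mg3 : inM (g * g * g) by do 2![apply: inMM => //].
have Mm : inM m by exact: inMM.
have Mn : inM n by exact: inMM.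
have sm : star m = g * g * g * star x by rewrite /m !starM sg !mulrA.
have sn : star n = g * star x by rewrite /n starM sg.
have em : star m * m = g * g * g * (star x * x) * (g * g * g) by rewrite sm /m !mulrA.
have en : star n * n = g * (star x * x) * g by rewrite sn /n !mulrA.
rewrite -em in fm; rewrite -en in fn.
have {}cd : star c * d = star m * n by rewrite cd sm /n !mulrA.
have dc : star d * c = star n * m by rewrite -[c]starK -starM cd starM starK.
have key : star c * c + star d * d + (star m * m + star n * n) =
    star (c - d) * (c - d) + star (m + n) * (m + n).
  have -> : star (c - d) * (c - d) =
      star c * c + star d * d - (star m * n + star n * m).
    by rewrite starB mulrBl !mulrBr opprB cd dc addrACA -opprD.
  have -> : star (m + n) * (m + n) = star m * m + star n * n + (star m * n + star n * m).
    by rewrite starD mulrDl !mulrDr [X in _ + X = _]addrC addrACA.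
  by rewrite [RHS]addrACA addNr addr0.
pose y := x * (g * g * g * g) * star x.
have ey : y = (x * (g * g)) * star (x * (g * g)) by rewrite /y !starM sg !mulrA.
have My : inM y by rewrite ey; apply: inMM; [|apply: inM_star]; do 2![apply: inMM => //].
have py : pos y by rewrite ey; exact: pos_Mstar.
(* In the opposite order both mixed terms [m * star n] and [n * star m] equal the positive operator
   [y], to which the trace applies. *)
have key' : (m + n) * star (m + n) = m * star m + n * star n + 2 *: y.
  rewrite starD mulrDl !mulrDr [X in _ + X = _]addrC addrACA; congr (_ + _).
  have -> : m * star n = y by rewrite sn /m /y !mulrA.
  have -> : n * star m = y by rewrite sm /n /y !mulrA.
  by rewrite scaler_nat.
have MS z : inM z -> inM (z * star z) by move=> hz; apply: inMM => //; exact: inM_star.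
(* Finiteness is what permits subtracting these two traces from both sides. *)
have fin : (T (star m * m) + T (star n * n))%E \is a fin_num.
  rewrite ge0_fin_numE ?adde_ge0 ?T_ge0 //; try (by exact: inM_starM); try (by exact: pos_starM).
  exact: lte_add_pinfty.
have Mcd : inM (c - d) by exact: inMB.
have Mmn : inM (m + n) by exact: inMD.
rewrite -TZ // -(leeD2lE _ _ fin).
have -> : (T (star m * m) + T (star n * n) + T (2 *: y) = T (star (m + n) * (m + n)))%E.
  rewrite (T_comm Mmn) key' (T_comm Mm) (T_comm Mn).
  rewrite TD; [|by apply: inMD; exact: MS|by apply: posD; exact: pos_Mstar|exact: inMZ|exact: posZ].
  by rewrite TD //; try (by exact: MS); exact: pos_Mstar.
rewrite addeC.
do 3![rewrite -TD; try (by exact: inM_starM); try (by exact: pos_starM);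
  try (by apply: inMD; exact: inM_starM); try (by apply: posD; exact: pos_starM)].
rewrite key; apply: T_le; [exact: inM_starM|exact: pos_starM|by apply: inMD; exact: inM_starM|].
by rewrite /ple addrK; exact: pos_starM.
Qed.

(** * Young's inequality for the trace *)

Lemma T_young_pos a b (p q : R) : 0 < p -> 0 < q -> p^-1 + q^-1 = 1 ->
  inM a -> pos a -> inM b -> pos b ->
  (T (absb (a * b)) <= p^-1%:E * T (powb a p) + q^-1%:E * T (powb b q))%E.
Proof.
move=> p0 q0 pq Ma pa Mb pb; set K := (_ + _)%E.
have h2 : 0 < 2^-1 :> R by rewrite invr_gt0.
have Map : inM (powb a p) by exact: powb_inM.
have pap : pos (powb a p) by exact: powb_pos.
have Mbq : inM (powb b q) by exact: powb_inM.
have pbq : pos (powb b q) by exact: powb_pos.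
(* The case split is on [b] only, because the cutoff acts on [b]. *)
have [inf|fin] := leP +oo%E (T (powb b q)).
  have -> : K = +oo%E; last exact: leey.
  have -> : K = (p^-1%:E * T (powb a p) + +oo)%E.
    rewrite /K; congr (_ + _)%E; move: inf; rewrite leye_eq => /eqP ->.
    by rewrite gt0_muley // lte_fin invr_gt0.
  rewrite addey // gt_eqF // (lt_le_trans (ltNyr 0)) //.
  by rewrite mule_ge0 ?lee_fin ?invr_ge0 ?(ltW p0) // T_ge0.
pose z := a * b; have Mz : inM z by exact: inMM.
apply: T_powb_sup => // d Cz G d0 hz hG.
have pG : pos G.
  apply: (fcr_pos hz hG) => t /andP[t0 _].
  by rewrite mulr_ge0 ?powR_ge0 // invr_ge0 addr_ge0 // ltW.
have MG : inM G by apply: fcr_inM hG; apply: inMM => //; exact: inM_star.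
pose r := powb G 2^-1.
have pr : pos r by exact: powb_pos.
have Mr : inM r by exact: powb_inM.
have rr : r * r = G by exact: powb_sqrt.
have zz : z * star z = a * (b * b) * a.
  by rewrite /z starM (pos_sa pa) (pos_sa pb) !mulrA.
(* The left side is [G * (z * star z) * G], the value at [z * star z] of [t ^ 2 / (t + d) ^ 2]. *)
have GG : ple (G * (a * (b * b) * a) * G) 1.
  rewrite -zz -(scale1r (1 : bop H)).
  have hF := fcrM hz (fcrM hz hG (@fcr_id _ _ _ Cz)) hG.
  apply: (fcr_le hz hF (fcrC _ Cz 1)) => t /andP[t0 _].
  have td : 0 < t + d by rewrite ltr_wpDl.
  have ts : t `^ 2^-1 * t `^ 2^-1 = t.
    by rewrite powR12_sqrt // -expr2 sqr_sqrtr.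
  have -> : t `^ 2^-1 * (t + d)^-1 * t * (t `^ 2^-1 * (t + d)^-1) =
      (t `^ 2^-1 * t `^ 2^-1) * t / (t + d) ^+ 2 by field; rewrite gt_eqF.
  rewrite ts -expr2 ler_pdivrMr ?exprn_gt0 // mul1r ler_pXn2r ?nnegrE ?(ltW td) //.
  by rewrite lerDl ltW.
pose x := r * a; have Mx : inM x by exact: inMM.
have sx : star x = a * r by rewrite /x starM (pos_sa pa) (pos_sa pr).
have xx : star x * x = a * G * a by rewrite sx /x -rr !mulrA.
have -> : T (star z * G * z) = T (x * (b * b) * star x).
  rewrite -rr.
  have -> : star z * (r * r) * z = star (r * z) * (r * z).
    by rewrite starM (pos_sa pr) !mulrA.
  rewrite T_comm; last exact: inMM.
  by rewrite starM (pos_sa pr) sx /x /z starM (pos_sa pa) (pos_sa pb) !mulrA.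
have [Cb hb] := pbd_exists pb; have Cb0 : 0 < Cb by case: hb.
have [L' L'0 hL'] := bop_opb (x * star x).
have [L2 L20 hL2] := bop_opb (star x * x).
have lx : ple (x * star x) L'%:B by apply: opb_ple => //; exact/pos_sa/pos_Mstar.
have lx2 : ple (star x * x) L2%:B by apply: opb_ple => //; exact/pos_sa/pos_starM.
have /choice [B hB] : forall e, exists B, fcr b Cb (cutoff e) B.
  by move=> e; apply: fcr_exists => //; apply: weierstrass => //; exact: cutoff_uc (ltW Cb0).
have pB e : pos (B e) by apply: (fcr_pos hb (hB e)) => t _; exact: cutoff_ge0.
have MB e : inM (B e) by exact: fcr_inM (hB e).
have hBB e := fcrM hb (hB e) (hB e).
have pBB e : pos (B e * B e) by rewrite -{1}(pos_sa (pB e)); exact: pos_starM.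
have MBB e : inM (B e * B e) by exact: inMM.
have conjP (c y : bop H) : pos y -> pos (c * y * star c).
  by move=> pd; have := pos_conj (star c) pd; rewrite starK.
have conjM (c y : bop H) : inM c -> inM y -> inM (c * y * star c).
  by move=> ? ?; have := @inM_conj y (star c); rewrite starK; apply => //; exact: inM_star.
have conjL (c y y' : bop H) : ple y y' -> ple (c * y * star c) (c * y' * star c).
  by move=> pd; have := ple_conj (star c) pd; rewrite starK.
have hbb := fcrM hb (@fcr_id _ _ b Cb) (@fcr_id _ _ b Cb).
apply: (@T_sup (fun e => x * (B e * B e) * star x)).
- by apply: conjM => //; exact: inMM.
- by apply: conjP; rewrite -{1}(pos_sa pb); exact: pos_starM.
- move=> e e0; split; [exact: conjM|exact: conjP|apply: conjL].
  apply: (fcr_le hb (hBB e) hbb) => t /andP[t0 _].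
  by rewrite ler_pM ?cutoff_ge0 ?cutoff_le // ltW.
- move=> e e' e0 ee'; apply: conjL; apply: (fcr_le hb (hBB e') (hBB e)) => t _.
  by rewrite ler_pM ?cutoff_ge0 ?cutoff_anti.
(* On [[0, Cb]] cutting off at [k] changes [t ^ 2] by at most [2 * Cb * k]. Conjugation by [x]
   multiplies this by at most [L'], and [k] makes the product equal to [e]. *)
- move=> e e0; pose k := e / L' / (2 * Cb).
  have k0 : 0 < k by rewrite !divr_gt0 // mulr_gt0.
  exists k => //.
  have l1 : ple (b * b) (B k * B k + (2 * Cb * k)%:B).
    apply: (fcr_le hb hbb (fcrD (hBB k) (fcrC b Cb _))) => t ht.
    by rewrite -!expr2; exact: cutoff_sqr.
  apply: ple_trans (conjL x _ _ l1) _.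
  rewrite mulrDr mulrDl /ple opprD addrACA subrr add0r bscalerAr bscalerAl mulr1.
  have -> : e%:B = (2 * Cb * k) *: L'%:B :> bop H.
    by rewrite scalerA; congr (_ *: _); rewrite /k; field; rewrite !gt_eqF.
  by rewrite -scalerBr; apply: posZ => //; exact/ltW/mulr_gt0/k0/mulr_gt0.
move=> e e0; pose g := powb (B e) 2^-1.
have pg : pos g by exact: powb_pos.
have sg : star g = g by exact: pos_sa.
have Mg : inM g by exact: powb_inM.
have gg : g * g = B e by exact: powb_sqrt.
(* With this [w] the product [star c * dd] below becomes [g * B e * (a * G * a) * g], and
   [a * G * a = star x * x] is the shape that [T_cauchy_schwarz] asks for. *)
pose w := G * a * B e.
have Mw : inM w by do 2![apply: inMM => //].
have cw : ple (star w * w) 1.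
  have := @contr_star _ _ (star w); rewrite starK; apply.
  have -> : w * star w = G * (a * (B e * B e) * a) * G.
    by rewrite /w !starM (pos_sa pG) (pos_sa pa) (pos_sa (pB e)) !mulrA.
  apply: ple_trans GG.
  have sGa : star (G * a) = a * G by rewrite starM (pos_sa pa) (pos_sa pG).
  have l1 : ple (B e * B e) (b * b).
    apply: (fcr_le hb (hBB e) hbb) => t /andP[t0 _].
    by rewrite ler_pM ?cutoff_ge0 ?cutoff_le // ltW.
  by have := conjL (G * a) _ _ l1; rewrite sGa !mulrA.
pose ra := powb a 2^-1.
have pra : pos ra by exact: powb_pos.
have Mra : inM ra by exact: powb_inM.
have rra : ra * ra = a by exact: powb_sqrt.
pose c := ra * w * g; pose dd := ra * g.
have hg : fcr b Cb (cutoff e) (g * g) by rewrite gg.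
have K1 : (T (star c * c) <= K)%E.
  have -> : star c * c = g * (star w * a * w) * g.
    by rewrite /c !starM sg (pos_sa pra) -rra !mulrA.
  exact: T_young_shift hg.
have K2 : (T (star dd * dd) <= K)%E.
  have -> : star dd * dd = g * (star 1 * a * 1) * g.
    by rewrite /dd starM sg (pos_sa pra) star1 mul1r mulr1 -rra !mulrA.
  apply: (T_young_shift _ _ _ _ _ _ _ _ _ _ _ _ hg) => //; first exact: inM1.
  by rewrite star1 mul1r /ple subrr; exact: pos0.
(* Used with [k = g] and [k = g * g * g], whose squares are the first and third powers of [B e];
   [T_cutoff_fin] makes their traces finite. *)
have finc (k : bop H) : inM k -> selfadj k -> (T (k * k) < +oo)%E ->
    (T (k * (star x * x) * k) < +oo)%E.
  move=> Mk sk fk.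
  have pk : pos (k * k) by rewrite -{1}sk; exact: pos_starM.
  have Mkk : inM (k * k) by exact: inMM.
  apply: (@le_lt_trans _ _ (L2%:E * T (k * k))%E); last first.
    by rewrite lte_mul_pinfty // ?lee_fin ?(ltW L20) // T_ge0.
  rewrite -TZ ?(ltW L20) //; apply: T_le.
  - by do 2![apply: inMM => //]; exact: inM_starM.
  - by have := pos_conj k (pos_starM x); rewrite sk.
  - exact: inMZ.
  by have := ple_conj k lx2; rewrite sk bscalerAr bscalerAl mulr1.
have cs : (2%:E * T (x * (g * g * g * g) * star x) <= T (star c * c) + T (star dd * dd))%E.
  apply: T_cauchy_schwarz => //.
  - by do 2![apply: inMM => //].
  - exact: inMM.
  - rewrite -[_ * star x * x]mulrA xx /c /dd /w !starM.
    rewrite sg (pos_sa pra) (pos_sa pG) (pos_sa pa) (pos_sa (pB e)).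
    by rewrite -gg !mulrA -(mulrA _ ra ra) rra.
  - apply: finc => //; apply: (@T_cutoff_fin b Cb _ _ e q _ _ _ _ hg) fin => // t ht.
      exact: cutoff_ge0.
    exact: cutoff_eq0 ht.
  apply: finc.
  - by do 2![apply: inMM => //].
  - by rewrite /selfadj !starM sg mulrA.
  have -> : g * g * g * (g * g * g) = B e * B e * B e by rewrite -gg !mulrA.
  apply: (@T_cutoff_fin b Cb _ _ e q _ _ _ _ (fcrM hb (hBB e) (hB e))) fin => // t ht.
    by rewrite !mulr_ge0 ?cutoff_ge0.
  by rewrite (cutoff_eq0 ht) mulr0.
have eB : g * g * g * g = B e * B e by rewrite -gg !mulrA.
rewrite eB in cs.
have {cs} : (2%:E * T (x * (B e * B e) * star x) <= 2%:E * K)%E.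
  apply: le_trans cs _; apply: le_trans (leeD K1 K2) _.
  by rewrite -[X in (X + _)%E]mul1e -[X in (_ + X)%E]mul1e -ge0_muleDl.
by rewrite lee_pmul2l.
Qed.

(** [x] enters [star (x * y) * (x * y)] only through [star x * x], the square of [absb x]. After a
    swap, [y] enters only through [y * star y], the square of [absb (star y)], and a second swap
    returns to the absolute value of [a * b]. *)
Lemma T_young (x y : bop H) (p q : R) : 0 < p -> 0 < q -> p^-1 + q^-1 = 1 -> inM x -> inM y ->
  (T (absb (x * y)) <= p^-1%:E * T (powb (absb x) p) + q^-1%:E * T (powb (absb y) q))%E.
Proof.
move=> p0 q0 pq Mx My; set a := absb x; set b := absb (star y).
have h2 : 0 < 2^-1 :> R by rewrite invr_gt0.
have pa : pos a by exact: absb_pos.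
have pb : pos b by exact: absb_pos.
have Ma : inM a by exact: absb_inM.
have Mb : inM b by apply: absb_inM; exact: inM_star.
have -> : T (absb (x * y)) = T (absb (a * b)).
  rewrite /absb.
  have -> : star (x * y) * (x * y) = star (a * y) * (a * y).
    rewrite !starM (pos_sa pa) -!mulrA (mulrA a) (mulrA (star x)).
    by rewrite /a absb_sqr.
  rewrite (T_powb_swap (inMM Ma My) h2) (T_powb_swap (inMM Ma Mb) h2); congr (T (powb _ _)).
  rewrite !starM (pos_sa pa) (pos_sa pb) -!mulrA (mulrA y) (mulrA b).
  by rewrite /b absb_sqr starK.
have -> : T (powb (absb y) q) = T (powb b q).
  by rewrite !powb_abs // starK T_powb_swap // divr_gt0.
exact: T_young_pos.
Qed.

(** Passing to the absolute value changes nothing by [absb_abs], and passing to the adjoint leaves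
    the trace of every power unchanged by [T_powb_swap]. *)
Lemma dagger_bop (x : bop H) (x' : H -> H) : dagger_choices x x' -> inM x ->
  exists x1 : bop H, [/\ x' = x1, inM x1 &
    forall r, 0 < r -> T (powb (absb x1) r) = T (powb (absb x) r)].
Proof.
move=> hx Mx.
have swap r : 0 < r -> T (powb (absb (star x)) r) = T (powb (absb x) r).
  by move=> r0; rewrite !powb_abs // starK -T_powb_swap // divr_gt0.
have Msx := inM_star Mx.
case: hx => ->.
- by exists x.
- by exists (star x); rewrite adjointE.
- by exists (absb x); rewrite abs_opE absb_abs; split=> //; exact: absb_inM.
exists (absb (star x)); rewrite adjointE abs_opE absb_abs; split=> //.
exact: absb_inM.
Qed.
End Trace.

Theorem corollary2p4 (R : realType) (H : hilbertType R) (M : set (H -> H))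
    (tr : (H -> H) -> \bar R)
    (hM : von_neumann_algebra M)
    (htr : is_trace M tr) (hfaithful : faithful_trace M tr)
    (hsemifinite : semifinite_trace M tr) (hnormal : normal_trace M tr)
    (p q : R) (hp : 0 < p) (hq : 0 < q) (hpq : p^-1 + q^-1 = 1)
    (x y : H -> H) (hx : M x) (hy : M y)
    (x' y' : H -> H) (hx' : dagger_choices x x') (hy' : dagger_choices y y') :
  (tr (abs_op (x' \o y')) <=
     p^-1%:E * tr (power_op (abs_op x) p) +
     q^-1%:E * tr (power_op (abs_op y) q))%E.
Proof.
pose X := Bop (vna_bounded hM hx); pose Y := Bop (vna_bounded hM hy).
have [X' [-> MX' eX]] := @dagger_bop _ _ _ _ hM htr hnormal X x' hx' hx.
have [Y' [-> MY' eY]] := @dagger_bop _ _ _ _ hM htr hnormal Y y' hy' hy.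
rewrite (abs_opE (X' * Y')) (abs_opE X) (abs_opE Y).
rewrite (power_opE hp (absb_pos X)) (power_opE hq (absb_pos Y)).
have := T_young hM htr hnormal hp hq hpq MX' MY'.
by rewrite (eX _ hp) (eY _ hq).
Qed.
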